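(* Let $n\ge2$, $1\le k\le n-1$, $\alpha>k-n$, $1\le p<\frac{\alpha+n}{k}$ and $\beta\in\mathbb{R}$. Consider the inequality $$\sup_{\xi\in\Xi_k(\mathbb{R}^n)}\big|d(0,\xi)^{\beta}R_kf(\xi)\big|\le C\|f\|_{L^p_\alpha(\mathbb{R}^n)}\quad\text{for all radial }f\in L^p_\alpha(\mathbb{R}^n),$$ with $C$ independent of $f$ (the supremum being an essential supremum). (A) If $k\ge2$, this holds if and only if $\beta=\frac{\alpha+n}{p}-k$. (B) If $k=1$, this holds if and only if $\beta=\frac{\alpha+n}{p}-k$ and $p>2$.
   Context: $\Xi_k(\mathbb{R}^n)$ is the set of affine $k$-planes in $\mathbb{R}^n$ with its invariant measure; $d(0,\xi)$ is the Euclidean distance from the origin to $\xi$. $R_kf(\xi)=\int_\xi f\,d_\xi x$ with $d_\xi x$ the $k$-dimensional Lebesgue measure on $\xi$. $L^p_\alpha(\mathbb{R}^n)$ is the space of measurable $f$ with $\int_{\mathbb{R}^n}|f(x)|^p\|x\|^\alpha dx<\infty$. Radial means depending only on $\|x\|$. *)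

(* Defs.v *)
From HB Require Import structures.
From Stdlib Require Import ClassicalEpsilon.
From mathcomp Require Import all_boot all_order all_algebra.
From mathcomp Require Import all_classical all_reals all_analysis.

Unset Strict Implicit.
Unset Printing Implicit Defensive.

Import Order.TTheory GRing.Theory Num.Theory.
Import numFieldNormedType.Exports.
Local Open Scope classical_set_scope.
Local Open Scope ring_scope.

Section Defs.
Variable R : realType.

(* Points of R^m are m-tuples of reals; the sigma-algebra on m.-tuple R is the
   library's product (= Borel) sigma-algebra. *)

(* Lebesgue measure on R^m, defined as the iterated product of the
   one-dimensional Lebesgue measure (m-fold product measure, Tonelli). *)
Fixpoint leb (m : nat) : set (m.-tuple R) -> \bar R :=
  match m return set (m.-tuple R) -> \bar R with
  | 0 => fun A => ((\1_A : 0.-tuple R -> R) [tuple])%:E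
  | m'.+1 => fun A =>
      (\int[@lebesgue_measure R]_x leb m' [set t | A (cons_tuple x t)])%E
  end.

Definition enorm {m : nat} (x : m.-tuple R) : R :=
  Num.sqrt (\sum_(i < m) tnth x i ^+ 2).

Definition aff_pt {n k : nat} (x : n.-tuple R) (U : 'M[R]_(n, k))
    (y : k.-tuple R) : n.-tuple R :=
  [tuple tnth x i + \sum_(j < k) U i j * tnth y j | i < n].

Definition is_frame {n : nat} (k : nat) (xi : set (n.-tuple R))
    (xU : n.-tuple R * 'M[R]_(n, k)) : Prop :=
  xU.2^T *m xU.2 = 1%:M /\ xi = range (aff_pt xU.1 xU.2).

Definition is_kplane {n : nat} (k : nat) (xi : set (n.-tuple R)) : Prop :=
  exists xU, is_frame k xi xU.

Definition frame_inhabited (n k : nat) :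
  inhabited (n.-tuple R * 'M[R]_(n, k)) :=
  inhabits ([tuple (0 : R) | _ < n], 0).

(* a chosen orthonormal frame of xi (meaningful when xi is a k-plane) *)
Definition frame {n : nat} (k : nat) (xi : set (n.-tuple R)) :
  n.-tuple R * 'M[R]_(n, k) :=
  epsilon (frame_inhabited n k) (is_frame k xi).

(* the function f restricted to xi, in the isometric coordinates y of xi;
   the k-dimensional Lebesgue measure d_xi x on xi is the image of the
   Lebesgue measure of R^k under y |-> x + U y *)
Definition on_plane {n : nat} (k : nat) (f : n.-tuple R -> R)
    (xi : set (n.-tuple R)) : k.-tuple R -> R :=
  fun y => f (aff_pt (frame k xi).1 (frame k xi).2 y).

Definition plane_integrable {n : nat} (k : nat) (f : n.-tuple R -> R)
    (xi : set (n.-tuple R)) : Prop :=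
  (leb k).-integrable setT (fun y => (on_plane k f xi y)%:E).

Definition radon {n : nat} (k : nat) (f : n.-tuple R -> R) (xi : set (n.-tuple R)) : R :=
  fine (\int[leb k]_y (on_plane k f xi y)%:E)%E.

Definition dist0 {n : nat} (xi : set (n.-tuple R)) : R :=
  inf [set enorm z | z in xi].

(* Parametrization of affine planes by R^{n(k+1)}: the parameter q encodes an
   n x k matrix A (the first k blocks of n coordinates) and a vector x (the
   last block); the associated set is x + A R^k, a k-plane when A has rank k.
   The pull-back of the invariant measure of Xi_k(R^n) and the Lebesgue
   measure of R^{n(k+1)} have the same null sets, so "almost every k-plane"
   (for the invariant measure) is "almost every parameter q". *)
Definition pcoord {n k : nat} (q : (k.+1 * n).-tuple R) (j i : nat) : R :=
  nth 0 q (j * n + i).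

Definition param_mat {n k : nat} (q : (k.+1 * n).-tuple R) : 'M[R]_(n, k) :=
  \matrix_(i < n, j < k) pcoord q j i.

Definition param_vec {n k : nat} (q : (k.+1 * n).-tuple R) : n.-tuple R :=
  [tuple pcoord q k i | i < n].

Definition plane_of {n k : nat} (q : (k.+1 * n).-tuple R) : set (n.-tuple R) :=
  range (aff_pt (param_vec q) (param_mat q)).

Definition radial {n : nat} (f : n.-tuple R -> R) : Prop :=
  forall x y : n.-tuple R, enorm x = enorm y -> f x = f y.

Definition in_Lp_alpha {n : nat} (p alpha : R) (f : n.-tuple R -> R) : Prop :=
  measurable_fun setT f /\
  (\int[leb n]_x (`|f x| `^ p * enorm x `^ alpha)%:E < +oo)%E.

Definition Lp_alpha_norm {n : nat} (p alpha : R) (f : n.-tuple R -> R) : R :=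
  fine (\int[leb n]_x (`|f x| `^ p * enorm x `^ alpha)%:E)%E `^ p^-1.

(* The inequality
     ess sup_{xi in Xi_k(R^n)} |d(0,xi)^beta R_k f(xi)| <= C ||f||_{L^p_alpha}
   for all radial f in L^p_alpha(R^n), with C independent of f.
   (The essential sup bound means: for almost every k-plane xi, R_k f(xi) is
   defined (f integrable on xi) and |d(0,xi)^beta R_k f(xi)| <= C ||f||.) *)
Definition radial_radon_ineq (n k : nat) (alpha p beta : R) : Prop :=
  exists C : R, forall f : n.-tuple R -> R,
    radial f -> in_Lp_alpha p alpha f ->
    {ae leb (k.+1 * n), forall q,
      plane_integrable k f (plane_of q) /\
      `|dist0 (plane_of q) `^ beta * radon k f (plane_of q)|
        <= C * Lp_alpha_norm p alpha f}.

End Defs.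

(* Main.v *)
(* In terms of t = |x|^2 everything becomes one-dimensional.  The law of the
   squared norm under Lebesgue measure on R^m has density c t^(m/2 - 1), so a
   radial f(x) = g(|x|^2) has weighted norm (c int |g|^p t^((alpha+n)/2 - 1))^(1/p)
   and, on a k-plane at distance r, integral c int_{t > r^2} g(t) (t - r^2)^(k/2 - 1).
   Dilations reduce the inequality to r = 1, where it is Hoelder's inequality; the
   dual norm of the kernel is finite at infinity because p < (alpha + n)/k and at
   t = 1 exactly when k >= 2 or p > 2.
   Conversely, shells of radius l, tested on planes at distance comparable to l,
   force beta, and for k = 1, p <= 2 truncations of the kernel are a counterexample.
   Such planes form a non-null set: otherwise their dilates would cover almost
   every plane by countably many null sets. *)
Require Import Defs.
From Stdlib Require ClassicalEpsilon.
From HB Require Import structures.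
From mathcomp Require Import all_boot all_order all_algebra.
From mathcomp Require Import all_classical all_reals all_analysis.
From mathcomp Require Import measurable_realfun ring lra.
From mathcomp Require polyrcf.

Import Order.TTheory GRing.Theory Num.Theory.
Import numFieldNormedType.Exports.
Local Open Scope classical_set_scope.
Local Open Scope ring_scope.

(** Dilations and translations are the only symmetries of Lebesgue measure that enter. Dilations
    give the volume of balls, hence the law of the squared norm. On a plane with orthonormal frame
    [(x, U)], Pythagoras gives [|x + U y|^2 = r^2 + |y + U^T x|^2] with [r] the distance to the
    origin, so a translation of [y] removes the choice of the frame. This matters because [frame]
    picks one by [epsilon] and only its defining property is known. The almost everywhere quantifier
    over parameters acts twice. For sufficiency, one determinant, a nonzero polynomial in the
    parameter, excludes both the matrices of rank below [k] and the planes through the origin. For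
    necessity, no individual plane can be tested: only some plane with distance in a prescribed
    window [[a, b[] is available, so each test function must give its lower bound uniformly over the
    window. The unknown signs of [alpha] and [beta] are absorbed by comparing powers on bounded
    ranges away from 0. *)

(** * Lebesgue measure on tuples as an iterated product measure *)

Section LebMeasure.
Variable R : realType.
Local Notation mu := (@lebesgue_measure R).
Local Notation consp m := (fun z : measurableTypeR R * m.-tuple R =>
  cons_tuple z.1 z.2 : m.+1.-tuple R).

Lemma measurable_consp m : measurable_fun setT (consp m).
Proof. exact: measurable_cons. Qed.

Lemma leb_succE m : leb R m.+1 =
  pushforward (product_measure1 mu (leb R m)) (consp m).
Proof.
apply/funext => A /=; rewrite /pushforward /product_measure1.
apply: eq_integral => x _ /=.
congr (leb R m _); apply/seteqP; split => t /=; rewrite /xsection/= ?inE //.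
Qed.

Section LebStep.
Variables (m : nat) (nu : {sigma_finite_measure set (m.-tuple R) -> \bar R}).

(** One recursion step of [leb] with the inner measure abstracted: the product is built from a
    structured sigma-finite [nu], which [leb R m] becomes only after the induction below. *)
Definition leb_step : set (m.+1.-tuple R) -> \bar R :=
  pushforward (product_measure1 mu nu) (consp m).

Let P : {measure set (m.+1.-tuple R) -> \bar R} :=
  measure_function_pushforward__canonical__measure_function_Measure
    (mu \x nu)%E (measurable_consp m).

HB.instance Definition _ := isMeasure.Build _ _ _ leb_step
  (measure0 P) (measure_ge0 P) (@measure_semi_sigma_additive _ _ _ P).

Lemma leb_step_sigma_finite : sigma_finite setT leb_step.
Proof.
have /sigma_finiteP[F [TF ndF Foo]] := @sigma_finiteT _ _ R mu.
have /sigma_finiteP[G [TG ndG Goo]] := sigma_finiteT nu.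
pose u (t : m.+1.-tuple R) : measurableTypeR R * m.-tuple R :=
  (thead t, behead_tuple t).
have mu_ : measurable_fun setT u.
  apply/measurable_fun_pairP; split.
    have h := @measurable_tnth _ R m.+1 ord0.
    exact: h.
  apply/measurable_fun_tnthP => i.
  rewrite (_ : _ \o _ = (@tnth _ R ^~ (lift ord0 i))); last first.
    by apply/funext => t /=; rewrite [in RHS](tuple_eta t) tnthS.
  exact: measurable_tnth.
have cK z : u (consp m z) = z.
  by case: z => x t; rewrite /u /= theadE; congr pair; apply/val_inj.
(* Both exhaustions are increasing, so boxes with a common index already cover: [maxn i j] serves
   both coordinates. *)
exists (fun i => u @^-1` (F i `*` G i)).
  apply/esym; rewrite -subTset => t _.
  have [i _ Fi] : (\bigcup_i F i) (u t).1 by rewrite -TF.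
  have [j _ Gj] : (\bigcup_i G i) (u t).2 by rewrite -TG.
  exists (maxn i j) => //; split.
    by apply: (subsetPset _ _ (ndF _ _ (leq_maxl i j))).
  by apply: (subsetPset _ _ (ndG _ _ (leq_maxr i j))).
move=> i; have [mFi Fi] := Foo i; have [mGi Gi] := Goo i; split.
  by rewrite -[X in measurable X]setTI; apply: mu_ => //; exact: measurableX.
rewrite /leb_step /pushforward (_ : _ @^-1` _ = F i `*` G i).
  by rewrite product_measure1E// lte_mul_pinfty// ge0_fin_numE.
by apply/seteqP; split => z; rewrite /preimage /mkset cK.
Qed.

HB.instance Definition _ := Measure_isSigmaFinite.Build _ _ _ leb_step
  leb_step_sigma_finite.

End LebStep.

(** The measure structure is built along the induction, so it is first obtained up to equality of
    functions; rewriting with that equality then gives [leb] its own instances. *)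
Lemma leb_sigma_finite_measure m :
  exists nu : {sigma_finite_measure set (m.-tuple R) -> \bar R},
    (nu : set (m.-tuple R) -> \bar R) = leb R m.
Proof.
elim: m => [|m [nu nuE]].
  exists (@dirac _ (0.-tuple R) [tuple] R).
  by apply/funext => A /=; rewrite diracE indicE.
by exists (leb_step _ nu); rewrite leb_succE -nuE.
Qed.

Lemma leb0 m : leb R m set0 = 0%E.
Proof. by have [nu <-] := leb_sigma_finite_measure m; exact: measure0. Qed.

Lemma leb_ge0 m A : (0 <= leb R m A)%E.
Proof. by have [nu <-] := leb_sigma_finite_measure m; exact: measure_ge0. Qed.

Lemma leb_sigma_additive m : semi_sigma_additive (leb R m).
Proof.
have [nu <-] := leb_sigma_finite_measure m.
exact: measure_semi_sigma_additive.
Qed.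

HB.instance Definition _ m := isMeasure.Build _ _ _ (leb R m)
  (leb0 m) (leb_ge0 m) (@leb_sigma_additive m).

Lemma leb_sigma_finite m : sigma_finite setT (leb R m).
Proof.
by have [nu <-] := leb_sigma_finite_measure m; exact: sigma_finiteT.
Qed.

HB.instance Definition _ m := Measure_isSigmaFinite.Build _ _ _ (leb R m)
  (leb_sigma_finite m).

Lemma ge0_integral_leb0 (F : 0.-tuple R -> \bar R) :
  measurable_fun setT F -> (\int[leb R 0]_y F y = F [tuple])%E.
Proof.
move=> mF; rewrite (eq_measure_integral (dirac ([tuple] : 0.-tuple R))).
  by rewrite integral_dirac// diracT mul1e.
by move=> A _ _ /=; rewrite diracE indicE.
Qed.

Lemma ge0_integral_lebS m (F : m.+1.-tuple R -> \bar R) :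
  measurable_fun setT F -> (forall y, 0 <= F y)%E ->
  (\int[leb R m.+1]_y F y =
   \int[mu]_x \int[leb R m]_t F (cons_tuple x t))%E.
Proof.
move=> mF F0.
have mc := measurable_consp m.
transitivity (\int[pushforward (mu \x leb R m) (consp m)]_y F y)%E.
  by rewrite leb_succE.
rewrite (ge0_integral_pushforward mc)//= (@fubini_tonelli1 _ _ _ _ R mu (leb R m)
  (fun z => F (consp m z)))//.
exact: measurableT_comp.
Qed.

Lemma measurable_fun_inner_leb m (F : m.+1.-tuple R -> \bar R) :
  measurable_fun setT F -> (forall y, 0 <= F y)%E ->
  measurable_fun setT
    (fun x : measurableTypeR R => \int[leb R m]_t F (cons_tuple x t))%E.
Proof.
move=> mF F0.
apply: (@measurable_fun_fubini_tonelli_F _ _ (measurableTypeR R) _ R (leb R m)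
  (F \o consp m)) => // [|z]; last exact: F0.
exact: measurableT_comp (measurable_consp m).
Qed.

End LebMeasure.

(** * Affine changes of variables *)

Section Affine.
Variable R : realType.
Local Notation mu := (@lebesgue_measure R).

Lemma measurable_affine (a b : R) :
  measurable_fun setT (fun x : measurableTypeR R => a * x + b : measurableTypeR R).
Proof.
apply: (@measurable_funD _ R) => //; apply: measurable_funM => //.
Qed.

(** Both sides are measures in [A], and Lebesgue measure is determined by its values on the
    intervals []c, d]]. *)
Lemma lebesgue_measure_affine (a b : R) (a0 : 0 < a) (A : set R) :
  measurable A -> mu A = (a%:E * mu [set x | A (a * x + b)%R])%E.
Proof.
move=> mA.
have an : 0 <= a := ltW a0.
pose nu := mscale (NngNum an)
  (measure_function_pushforward__canonical__measure_function_Measure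
    mu (measurable_affine a b)).
rewrite (@lebesgue_measure_unique R nu)// => _ [[c d]] _ <-.
change (mu `]c, d] = a%:E * mu [set x | `]c, d]%classic (a * x + b)%R])%E.
rewrite [X in (_ * _ X)%E](_ : _ =
  `](c - b) / a, (d - b) / a]%classic); last first.
  apply/seteqP; split => x /=; rewrite !in_itv/= ltr_pdivrMr// ler_pdivlMr//
    ltrBlDr lerBrDr [x * a]mulrC//.
rewrite !lebesgue_measure_itv/= !lte_fin ltr_pM2r ?invr_gt0// ltrD2r.
case: ifPn => _; last by rewrite mule0.
rewrite -!EFinB -EFinM; congr EFin; field; lra.
Qed.

Lemma ge0_integral_affine (a b : R) (F : R -> \bar R) : 0 < a ->
  measurable_fun setT F -> (forall x, 0 <= F x)%E ->
  (\int[mu]_x F (a * x + b)%R = (a^-1)%:E * \int[mu]_x F x)%E.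
Proof.
move=> a0 mF F0.
have an : 0 <= a := ltW a0.
pose P := measure_function_pushforward__canonical__measure_function_Measure
    mu (measurable_affine a b).
have -> : (\int[mu]_x F x = a%:E * \int[mu]_x F (a * x + b)%R)%E.
  rewrite (eq_measure_integral (mscale (NngNum an) P)); last first.
    by move=> A mA _; exact: (lebesgue_measure_affine _ b a0).
  rewrite ge0_integral_mscale//=.
  by rewrite (ge0_integral_pushforward (measurable_affine a b)).
by rewrite muleA -EFinM mulVf ?gt_eqF// mul1e.
Qed.

Definition scale_shift m (a : R) (v y : m.-tuple R) : m.-tuple R :=
  [tuple a * tnth y i + tnth v i | i < m].

Lemma measurable_scale_shift m a (v : m.-tuple R) :
  measurable_fun setT (scale_shift m a v).
Proof.
apply/measurable_fun_tnthP => i.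
rewrite (_ : _ \o _ = fun y : m.-tuple R => a * tnth y i + tnth v i); last first.
  by apply/funext => y /=; rewrite tnth_mktuple.
apply: measurable_funD => //; apply: measurable_funM => //.
exact: measurable_tnth.
Qed.

Lemma scale_shift_cons m a (v : m.+1.-tuple R) x y :
  scale_shift m.+1 a v (cons_tuple x y) =
  cons_tuple (a * x + thead v) (scale_shift m a (behead_tuple v) y).
Proof.
apply: eq_from_tnth => i; rewrite tnth_mktuple.
case: (unliftP ord0 i) => [j ->|->]; last by rewrite !tnth0.
by rewrite !tnthS tnth_mktuple [in LHS](tuple_eta v) tnthS.
Qed.

(** Tonelli peels off one coordinate at a time, and each contributes one factor [a^-1]. *)
Lemma ge0_integral_leb_affine m a (v : m.-tuple R) (F : m.-tuple R -> \bar R) :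
  0 < a -> measurable_fun setT F -> (forall y, 0 <= F y)%E ->
  (\int[leb R m]_y F (scale_shift m a v y) =
   ((a^-1) ^+ m)%:E * \int[leb R m]_y F y)%E.
Proof.
move=> a0; elim: m v F => [|m IH] v F mF F0.
  rewrite !ge0_integral_leb0 ?expr0 ?mul1e//.
    by congr F; apply/val_inj; rewrite (tuple0 (scale_shift _ _ _ _)).
  exact: measurableT_comp (measurable_scale_shift _ _ _).
have mFs : measurable_fun setT (F \o scale_shift _ a v).
  exact: measurableT_comp (measurable_scale_shift _ _ _).
rewrite (ge0_integral_lebS _ _ _ mFs) => [|y]; last exact: F0.
rewrite (ge0_integral_lebS _ _ _ mF)//.
transitivity (\int[mu]_x (((a^-1) ^+ m)%:E *
   \int[leb R m]_t F (cons_tuple (a * x + thead v)%R t)))%E.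
  apply: eq_integral => x _ /=.
  under eq_integral do rewrite scale_shift_cons.
  apply: (IH (behead_tuple v) (fun t => F (cons_tuple (a * x + thead v)%R t))) => //.
  by apply: measurableT_comp => //; exact: measurable_cons.
have mI := measurable_fun_inner_leb _ _ _ mF F0.
have I0 x : (0 <= \int[leb R m]_t F (cons_tuple x t))%E by exact: integral_ge0.
rewrite ge0_integralZl_EFin; last 4 first.
- exact: measurableT.
- by move=> x _; exact: I0.
- exact: (measurableT_comp mI (measurable_affine a (thead v))).
- by rewrite exprn_ge0// invr_ge0 ltW.
rewrite (ge0_integral_affine _ _ (fun x => \int[leb R m]_t F (cons_tuple x t))%E)//.
by rewrite muleA -EFinM exprSr.
Qed.

Definition dilate m (a : R) : m.-tuple R -> m.-tuple R :=
  scale_shift m a [tuple 0 | _ < m].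

Lemma leb_scale m a (A : set (m.-tuple R)) : 0 < a -> measurable A ->
  leb R m A = ((a ^+ m)%:E * leb R m (dilate m a @^-1` A))%E.
Proof.
move=> a0 mA.
have mS : measurable (dilate m a @^-1` A).
  by rewrite -[X in measurable X]setTI; apply: measurable_scale_shift.
have h : (\int[leb R m]_y (\1_A (dilate m a y))%:E =
    ((a^-1) ^+ m)%:E * \int[leb R m]_y (\1_A y)%:E)%E.
  apply: (ge0_integral_leb_affine _ _ _ (fun y => (\1_A y)%:E)) => //.
  by apply/measurable_EFinP; exact: measurable_indic.
have h1 : (\int[leb R m]_y (\1_A y)%:E = leb R m A)%E.
  by rewrite integral_indic ?setIT.
have h2 : (\int[leb R m]_y (\1_A (dilate m a y))%:E =
    leb R m (dilate m a @^-1` A))%E.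
  by rewrite -[X in leb R m X]setIT -integral_indic.
rewrite -h2 h h1 muleA -EFinM -exprMn divff ?gt_eqF// expr1n mul1e//.
Qed.
End Affine.

(** * Measures given by a density *)

Section Density.
Local Open Scope ereal_scope.
Context (d : measure_display) (T : measurableType d) (R : realType).
Variables (mu : {measure set T -> \bar R}) (h : T -> R).
Hypotheses (mh : measurable_fun setT h) (h0 : forall x, (0 <= h x)%R).

Definition density (A : set T) : \bar R := \int[mu]_(x in A) (h x)%:E.

Let mhE (A : set T) : measurable_fun A (EFin \o h).
Proof. by apply: measurable_funTS; exact/measurable_EFinP. Qed.

Let density0 : density set0 = 0.
Proof. exact: integral_set0. Qed.

Let density_ge0 A : 0 <= density A.
Proof. by apply: integral_ge0 => x _; rewrite lee_fin. Qed.

Let density_sigma_additive : semi_sigma_additive density.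
Proof.
move=> F mF tF mUF; rewrite /density ge0_integral_bigcup//=.
- apply: is_cvg_ereal_nneg_natsum_cond => n _ _.
  by apply: integral_ge0 => x _; rewrite lee_fin.
- by move=> x _; rewrite lee_fin.
Qed.

HB.instance Definition _ := isMeasure.Build _ _ _ density
  density0 density_ge0 density_sigma_additive.

Definition density_measure : {measure set T -> \bar R} := density.

Import HBNNSimple.

(** Simple functions increase to [G]; monotone convergence on both sides reduces the identity to
    indicators of level sets. *)
Lemma ge0_integral_density (G : T -> \bar R) :
  measurable_fun setT G -> (forall x, 0 <= G x) ->
  \int[density]_x G x = \int[mu]_x (G x * (h x)%:E).
Proof.
move=> mG G0; pose g := nnsfun_approx measurableT mG.
have gcvg x : (g n x)%:E @[n --> \oo] --> G x.
  by apply: cvg_nnsfun_approx => // y _; exact: G0.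
have gnd x : {homo (fun n => g n x) : m n / (m <= n)%N >-> (m <= n)%R}.
  by move=> m n mn; exact/lefP/nd_nnsfun_approx.
have mg n : measurable_fun setT (EFin \o g n) by exact/measurable_EFinP.
transitivity (limn (fun n => \int[density]_x (g n x)%:E)).
  rewrite -monotone_convergence//.
  - by apply: eq_integral => x _; apply/esym/cvg_lim => //; exact: gcvg.
  - by move=> n x _; rewrite lee_fin.
  - by move=> x _ m n mn; rewrite lee_fin; exact: gnd.
transitivity (limn (fun n => \int[mu]_x ((g n x)%:E * (h x)%:E))); last first.
  rewrite -monotone_convergence//.
  - apply: eq_integral => x _; apply/cvg_lim => //.
    by apply: cvgeZr => //; exact: gcvg.
  - by move=> n; exact: emeasurable_funM (mg n) (mhE _).
  - by move=> n x _; rewrite -EFinM lee_fin mulr_ge0.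
  - move=> x _ m n mn; rewrite -!EFinM lee_fin.
    by apply: ler_wpM2r => //; exact: gnd.
congr (limn _); apply/funext => n.
transitivity (\sum_(k \in range (g n))
    \int[density]_x (k * \1_(g n @^-1` [set k]) x)%:E).
  under eq_integral do rewrite fimfunE -fsumEFin//.
  rewrite ge0_integral_fsum//.
  - by move=> y; exact/measurable_EFinP/measurable_funM.
  - by move=> y x _; rewrite nnfun_muleindic_ge0.
transitivity (\sum_(k \in range (g n))
    \int[mu]_x ((k * \1_(g n @^-1` [set k]) x)%:E * (h x)%:E)); last first.
  rewrite -ge0_integral_fsum//.
  - apply: eq_integral => x _; rewrite -ge0_mule_fsuml; last first.
      by move=> k; rewrite nnfun_muleindic_ge0.
    by rewrite fsumEFin// -fimfunE.
  - move=> y; apply: emeasurable_funM (mhE _).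
    exact/measurable_EFinP/measurable_funM.
  - by move=> y x _; apply: mule_ge0; rewrite ?nnfun_muleindic_ge0 ?lee_fin.
apply: eq_fsbigr => k _.
(* The index [k] is no longer known to be a value of [g n]; for negative [k] the level set is empty
   because [g n] is nonnegative. *)
have [k0|k0] := leP 0%R k; last first.
  have g0 x : \1_(g n @^-1` [set k]) x = 0%R :> R.
    by rewrite preimage_nnfun0// indic0.
  transitivity (0 : \bar R); [|apply/esym]; apply: integral0_eq => x _.
    by rewrite g0 mulr0.
  by rewrite g0 mulr0 mul0e.
pose A := g n @^-1` [set k].
have mA : measurable A by exact: measurable_sfunP.
have mIA : measurable_fun setT (EFin \o (\1_A : T -> R)).
  exact/measurable_EFinP/measurable_indic.
transitivity (k%:E * density A).
  transitivity (\int[density]_x (k%:E * (\1_A x)%:E)).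
    by apply: eq_integral => x _; rewrite EFinM.
  rewrite (ge0_integralZl_EFin _ _ _ mIA)//; last first.
    by move=> x _; rewrite /= lee_fin.
  by rewrite integral_indic//= setIT.
transitivity (\int[mu]_x (k%:E * ((h x)%:E * (\1_A x)%:E))); last first.
  by apply: eq_integral => x _; rewrite EFinM -muleA; congr (_ * _); rewrite muleC.
rewrite (ge0_integralZl_EFin _ _ _ (emeasurable_funM (mhE _) mIA))//.
  by rewrite /density integral_mkcond epatch_indic.
by move=> x _; rewrite -EFinM lee_fin mulr_ge0.
Qed.

End Density.

(** * Integrals of powers *)

Section PowerIntegrals.
Variable R : realType.
Local Notation mu := (@lebesgue_measure R).

Lemma gt0_continuous_FTC2 (f F : R -> R) (c d : R) : 0 < c -> c < d ->
  (forall x : R, 0 < x -> derivable f x 1) ->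
  (forall x : R, 0 < x -> is_derive x 1 F (f x)) ->
  (\int[mu]_(t in `[c, d]) (f t)%:E = (F d - F c)%:E)%E.
Proof.
move=> c0 cd df dF.
have cF (x : R) : 0 < x -> {for x, continuous F}.
  move=> x0; apply/differentiable_continuous/derivable1_diffP.
  by have [] := dF x x0.
rewrite (@continuous_FTC2 _ f F) ?EFinB//.
- apply: derivable_within_continuous => x; rewrite in_itv/= => /andP[cx _].
  by apply: df; exact: lt_le_trans cx.
- split.
  + move=> x; rewrite in_itv/= => /andP[cx _].
    by have [] := dF x (lt_trans c0 cx).
  + exact/cvg_at_right_filter/cF.
  + by apply/cvg_at_left_filter/cF; exact: lt_trans cd.
- move=> x; rewrite in_itv/= => /andP[cx _].
  by rewrite derive1E; have [] := dF x (lt_trans c0 cx).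
Qed.

Lemma integral_powR_itvcc (a c d : R) : a != 0 -> 0 < c -> c < d ->
  (\int[mu]_(t in `[c, d]) (t `^ (a - 1))%:E =
   ((d `^ a - c `^ a) / a)%:E)%E.
Proof.
move=> a0 c0 cd.
have dF (x : R) : 0 < x ->
    is_derive x 1 (a^-1 \*: (@powR R ^~ a)) (x `^ (a - 1)).
  move=> x0; have := @is_deriveZ _ _ _ (@powR R ^~ a) a^-1 x 1 _
    (is_derive1_powR a x0).
  by rewrite /GRing.scale/= mulKf.
rewrite (gt0_continuous_FTC2 (@powR R ^~ (a - 1)) _ _ _ c0 cd _ dF).
  by congr EFin; rewrite /= /GRing.scale /=; field.
by move=> x x0; apply: derivable_powR; rewrite in_itv/= x0.
Qed.

Lemma integral_inv_itvcc (c d : R) : 0 < c -> c < d ->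
  (\int[mu]_(t in `[c, d]) (t^-1)%:E = (ln d - ln c)%:E)%E.
Proof.
move=> c0 cd.
rewrite (gt0_continuous_FTC2 (@GRing.inv R) _ _ _ c0 cd _ (@is_derive1_ln R))//.
by move=> x x0; apply: derivableV; rewrite ?gt_eqF.
Qed.

Lemma integral_powR_itv0 (a b : R) : 0 < a -> 0 < b ->
  (\int[mu]_(t in `]0%R, b]) (t `^ (a - 1))%:E = (b `^ a / a)%:E)%E.
Proof.
move=> a0 b0.
(* The shift [i.+2] keeps the left end strictly below [b] even for [i = 0], as the fundamental
   theorem of calculus requires. *)
pose F i := `[b / i.+2%:R, b]%classic : set (measurableTypeR R).
have FU : \bigcup_i F i = `]0, b]%classic.
  apply/seteqP; split => [x [i _]|x]; rewrite /F /= !in_itv/=.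
    by move=> /andP[bx ->]; rewrite (lt_le_trans _ bx)// divr_gt0.
  move=> /andP[x0 xb]; exists (Num.truncn (b / x)) => //=.
  rewrite in_itv/= xb andbT ler_pdivrMr// mulrC -ler_pdivrMr//.
  by rewrite ltW// (lt_le_trans (truncnS_gt _))// ler_nat.
have bi i : b / i.+2%:R < b by rewrite gtr_pMr// invf_lt1 ?ltr1n.
have mp : measurable_fun setT (fun t : R => (t `^ (a - 1))%:E).
  by apply/measurable_EFinP; exact: measurable_powR.
have cv : (\int[mu]_(t in F i) (t `^ (a - 1))%:E @[i --> \oo] -->
    \int[mu]_(t in `]0%R, b]) (t `^ (a - 1))%:E)%E.
  rewrite -FU; apply: ge0_nondecreasing_set_cvg_integral.
  - apply/nondecreasing_seqP => i; rewrite subsetEset => x.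
    rewrite /F /= !in_itv/= => /andP[bx ->]; rewrite andbT (le_trans _ bx)//.
    by rewrite ler_pM2l// lef_pV2 ?posrE// ler_nat.
  - by move=> i; exact: measurable_itv.
  - by move=> i; exact: measurable_funTS.
  - by move=> i x _; rewrite lee_fin powR_ge0.
have E i : (\int[mu]_(t in F i) (t `^ (a - 1))%:E =
    ((b `^ a - (b / i.+2%:R) `^ a) / a)%:E)%E.
  by rewrite integral_powR_itvcc ?gt_eqF ?divr_gt0.
suff cv2 : (\int[mu]_(t in F i) (t `^ (a - 1))%:E @[i --> \oo] -->
    (b `^ a / a)%:E)%E by exact: cvg_unique cv cv2.
under eq_fun do rewrite E.
apply: cvg_EFin; first exact: nearW.
rewrite -[X in _ --> X](_ : (b `^ a - 0) / a = _); last by rewrite subr0.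
apply: cvgMl; apply: cvgB; first exact: cvg_cst.
apply: ((cvg_at_rightP (@powR R ^~ a) 0 0).1 (powR_cvg0 a0)
  (fun i => b / i.+2%:R)); split; first by move=> i; rewrite divr_gt0.
rewrite -[X in _ --> X](mulr0 b); apply: cvgMr.
by have := @cvg_harmonic R; rewrite -cvg_shiftS.
Qed.

(** Only finiteness of the tail matters later, so on each [[b, b + i.+1]] the boundary term at the
    upper end is discarded. *)
Lemma integral_powR_itvy (a b : R) : 0 < a -> 0 < b ->
  (\int[mu]_(t in `[b, +oo[) (t `^ (- a - 1))%:E <= (b `^ (- a) / a)%:E)%E.
Proof.
move=> a0 b0.
pose F i := `[b, b + i.+1%:R]%classic : set (measurableTypeR R).
have FU : \bigcup_i F i = `[b, +oo[%classic.
  apply/seteqP; split => [x [i _]|x]; rewrite /F /= !in_itv/=.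
    by move=> /andP[->].
  rewrite andbT => bx; exists (Num.truncn (x - b)) => //=.
  by rewrite in_itv/= bx -lerBlDl ltW// truncnS_gt.
have bi i : b < b + i.+1%:R by rewrite ltrDl.
have mp : measurable_fun setT (fun t : R => (t `^ (- a - 1))%:E).
  by apply/measurable_EFinP; exact: measurable_powR.
have cv : (\int[mu]_(t in F i) (t `^ (- a - 1))%:E @[i --> \oo] -->
    \int[mu]_(t in `[b, +oo[) (t `^ (- a - 1))%:E)%E.
  rewrite -FU; apply: ge0_nondecreasing_set_cvg_integral.
  - apply/nondecreasing_seqP => i; rewrite subsetEset => x.
    rewrite /F /= !in_itv/= => /andP[-> bx]/=; rewrite (le_trans bx)//.
    by rewrite lerD2l ler_nat.
  - by move=> i; exact: measurable_itv.
  - by move=> i; exact: measurable_funTS.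
  - by move=> i x _; rewrite lee_fin powR_ge0.
rewrite -(cvg_lim _ cv)//; apply: lime_le; first by apply/cvg_ex; eexists; exact: cv.
apply: nearW => i; rewrite integral_powR_itvcc ?oppr_eq0 ?gt_eqF//.
rewrite lee_fin invrN mulrN -mulNr opprB ler_pM2r ?invr_gt0// gerBl.
exact: powR_ge0.
Qed.

End PowerIntegrals.

(** * Volumes of balls and the radial density *)

Section Polar.
Variable R : realType.
Local Notation mu := (@lebesgue_measure R).

(** Preferred to [enorm] because it is polynomial in the coordinates and additive under orthogonal
    decompositions. *)
Definition sqn {m} (y : m.-tuple R) : R := \sum_(i < m) tnth y i ^+ 2.

Lemma sqn_ge0 m (y : m.-tuple R) : 0 <= sqn y.
Proof. by apply: sumr_ge0 => i _; exact: sqr_ge0. Qed.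

Lemma enormE m (y : m.-tuple R) : enorm R y = Num.sqrt (sqn y).
Proof. by []. Qed.

Lemma measurable_sqn m : measurable_fun setT (@sqn m).
Proof.
apply: measurable_sum => i; apply: measurable_funX; exact: measurable_tnth.
Qed.

Lemma sqn_dilate m a (y : m.-tuple R) : sqn (dilate R m a y) = a ^+ 2 * sqn y.
Proof.
rewrite /sqn mulr_sumr; apply: eq_bigr => i _.
by rewrite tnth_mktuple tnth_mktuple addr0 exprMn.
Qed.

(** A set of explicit volume, to be compared with balls: it shows that the unit ball has finite and
    positive volume. *)
Definition cube m : set (m.-tuple R) := [set y | forall i, `|tnth y i| <= 1].

Lemma leb_cube m : leb R m (cube m) = (2 ^+ m)%:E.
Proof.
elim: m => [|m IH] /=.
  by rewrite indicE mem_set// => -[].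
transitivity (\int[mu]_x ((2 ^+ m)%:E * (\1_(`[-1, 1]%classic) x)%:E))%E.
  apply: eq_integral => x _; rewrite indicE.
  have [x1|x1] := boolP (`|x| <= 1); last first.
    rewrite (_ : [set t | _] = set0) ?leb0.
      by rewrite memNset ?mule0//= in_itv/= -ler_norml; exact/negP.
    rewrite -subset0 => t /(_ ord0); rewrite tnth0 => h.
    by rewrite h in x1.
  rewrite mem_set ?mule1 -?IH; last by rewrite /= in_itv/= -ler_norml.
  congr (leb R m _); apply/seteqP; split => t /= h i.
    by have := h (lift ord0 i); rewrite tnthS.
  by case: (unliftP ord0 i) => [j ->|->]; rewrite ?tnthS ?tnth0.
have mI : measurable_fun setT (fun x : R => (\1_(`[-1, 1]%classic) x : R)%:E).
  by apply/measurable_EFinP; exact: measurable_indic.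
rewrite ge0_integralZl_EFin//.
rewrite integral_indic//= setIT lebesgue_measure_itv/= lte_fin.
by rewrite ifT; [rewrite -EFinM exprSr; congr EFin; ring|lra].
Qed.

Lemma measurable_cube m : measurable (cube m).
Proof.
rewrite (_ : cube m = \bigcap_(i in [set: 'I_m])
    ((fun y : m.-tuple R => tnth y i) @^-1` `[-1, 1])); last first.
  apply/seteqP; split => y /= h.
    by move=> i _ /=; rewrite in_itv/= -ler_norml.
  by move=> i; have := h i I; rewrite /= in_itv/= -ler_norml.
apply: fin_bigcap_measurable => // i _.
rewrite -[X in measurable X]setTI.
by apply: measurable_tnth => //; exact: measurable_itv.
Qed.

Definition sball m (t : R) : set (m.-tuple R) := [set y | sqn y <= t].

Lemma measurable_sball m t : measurable (sball m t).
Proof.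
rewrite (_ : sball m t = setT `&` @sqn m @^-1` `]-oo, t]); last first.
  by rewrite setTI; apply/seteqP; split => y /=; rewrite in_itv/=.
by apply: measurable_sqn => //; exact: measurable_itv.
Qed.

Lemma leb_sball m t : 0 < t ->
  leb R m (sball m t) = ((t `^ (m%:R / 2))%:E * leb R m (sball m 1))%E.
Proof.
move=> t0; have s0 : 0 < Num.sqrt t by rewrite sqrtr_gt0.
rewrite (leb_scale _ _ _ _ s0 (measurable_sball m t)); congr (_ * leb R m _)%E.
  congr EFin; rewrite -powR12_sqrt ?(ltW t0)// -powR_mulrn ?powR_ge0// -powRrM.
  by rewrite mulrC.
apply/seteqP; split => y; rewrite /sball /= sqn_dilate sqr_sqrtr ?(ltW t0)//.
  by rewrite ger_pMr.
by rewrite ger_pMr.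
Qed.

Lemma leb_sball1_lty m : (leb R m (sball m 1) < +oo)%E.
Proof.
apply: (@le_lt_trans _ _ (leb R m (cube m))); last by rewrite leb_cube ltry.
apply: le_measure; rewrite ?inE; [exact: measurable_sball|exact: measurable_cube|].
move=> y y1 i; rewrite -sqrtr_sqr -[leRHS]sqrtr1 ler_wsqrtr// (le_trans _ y1)//.
by rewrite /sqn (bigD1 i)//= lerDl; apply: sumr_ge0 => j _; exact: sqr_ge0.
Qed.

Lemma leb_sball1_gt0 m : (0 < leb R m (sball m 1))%E.
Proof.
(* The cube lies in the ball of squared radius [m], which a dilation compares with the unit ball;
   adding 1 keeps the radius positive when [m = 0]. *)
suff h : (0 < leb R m (sball m (m%:R + 1)))%E.
  have m0 : 0 < m%:R + 1 :> R by rewrite ltr_wpDl.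
  rewrite leb_sball// in h; rewrite lt0e measure_ge0 andbT.
  by apply/eqP => h0; move: h; rewrite h0 mule0 ltxx.
apply: (@lt_le_trans _ _ (leb R m (cube m))).
  by rewrite leb_cube lte_fin exprn_gt0.
apply: le_measure; rewrite ?inE; [exact: measurable_cube|exact: measurable_sball|].
move=> y y1; rewrite /sball /=.
apply: (@le_trans _ _ (\sum_(i < m) 1)).
  by apply: ler_sum => i _; rewrite -real_normK ?num_real// expr_le1.
by rewrite sumr_const card_ord lerDl.
Qed.

Definition ball_vol m : R := fine (leb R m (sball m 1)).

Lemma ball_vol_gt0 m : 0 < ball_vol m.
Proof. by rewrite fine_gt0// leb_sball1_gt0 leb_sball1_lty. Qed.

Lemma leb_sballE m t : 0 < t ->
  leb R m (sball m t) = (t `^ (m%:R / 2) * ball_vol m)%:E.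
Proof.
move=> t0; rewrite leb_sball// EFinM fineK// ge0_fin_numE ?leb_sball1_lty//.
Qed.

(* The density of the law of the squared norm under [leb]. *)
Definition radial_density m (t : R) : R :=
  m%:R / 2 * ball_vol m * (\1_(`]0, +oo[%classic) t * t `^ (m%:R / 2 - 1)).

Lemma measurable_radial_density m :
  measurable_fun setT (radial_density m : measurableTypeR R -> R).
Proof.
apply: measurable_funM => //; apply: measurable_funM => //.
Qed.

Lemma radial_density_ge0 m t : 0 <= radial_density m t.
Proof.
rewrite /radial_density !mulr_ge0 ?powR_ge0 ?(ltW (ball_vol_gt0 _))//.
Qed.

Lemma radial_density_itvNy m b : (0 < m)%N -> 0 < b ->
  (\int[mu]_(t in `]-oo, b]) (radial_density m t)%:E =
   (b `^ (m%:R / 2) * ball_vol m)%:E)%E.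
Proof.
move=> m0 b0; pose c := m%:R / 2 * ball_vol m.
have a0 : 0 < m%:R / 2 :> R by rewrite divr_gt0// ltr0n.
have c0 : 0 <= c by rewrite mulr_ge0 ?ltW// ball_vol_gt0.
rewrite integral_mkcond.
transitivity (\int[mu]_t (c%:E *
    ((EFin \o (@powR R ^~ (m%:R / 2 - 1)%R)) \_ `]0%R, b]) t))%E.
  apply: eq_integral => t _; rewrite !patchE.
  rewrite /radial_density -/c indicE.
  have [t0|t0] := boolP (t \in `]0%R, +oo[%classic); last first.
    rewrite mul0r mulr0 [X in _ = (_ * X)%E](_ : _ = 0%E) ?mule0.
      by case: ifP.
    rewrite memNset//; move: t0; rewrite notin_setE/= !in_itv/= andbT => t0.
    by move=> /andP[].
  move: t0; rewrite inE/= in_itv/= andbT => t0.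
  rewrite mul1r; have [tb|tb] := leP t b.
    by rewrite !mem_set/= ?EFinM// in_itv/= ?t0.
  by rewrite !memNset/= ?mule0// in_itv/= ?t0/= leNgt tb.
rewrite ge0_integralZl_EFin//.
- rewrite -integral_mkcond integral_powR_itv0// -EFinM; congr EFin.
  by rewrite /c; field; rewrite pnatr_eq0 -lt0n.
- by move=> t _; rewrite patchE; case: ifP => // _; rewrite lee_fin powR_ge0.
- apply/(measurable_restrictT _ _).1 => //.
  by apply: measurable_funTS; apply/measurable_EFinP; exact: measurable_powR.
Qed.

End Polar.

(** * The law of the squared norm *)

Section PolarFormula.
Variable R : realType.
Local Notation mu := (@lebesgue_measure R).

Lemma leb_sball_le0 m t : (0 < m)%N -> t <= 0 -> leb R m (sball R m t) = 0%E.
Proof.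
move=> m0 t0; apply/eqP; rewrite eq_le measure_ge0 andbT.
apply/lee_addgt0Pr => e e0; rewrite add0e.
have V0 := ball_vol_gt0 R m.
have a0 : 0 < m%:R / 2 :> R by rewrite divr_gt0// ltr0n.
(* The squared radius for which the ball has volume exactly [e]. *)
pose s := (e / ball_vol R m) `^ (m%:R / 2)^-1.
have s0 : 0 < s by rewrite powR_gt0 ?divr_gt0.
apply: (@le_trans _ _ (leb R m (sball R m s))).
  apply: le_measure; rewrite ?inE; [exact: measurable_sball..|].
  by move=> y /= h; rewrite /sball/= (le_trans h)// (le_trans t0)// ltW.
rewrite leb_sballE// /s -powRrM mulVf ?gt_eqF// powRr1; last first.
  by rewrite divr_ge0// ltW.
by rewrite divfK// gt_eqF.
Qed.

Lemma radial_density_itvNy_le0 m b : b <= 0 ->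
  (\int[mu]_(t in `]-oo, b]) (radial_density R m t)%:E = 0)%E.
Proof.
move=> b0; apply: integral0_eq => t /=; rewrite in_itv/= => tb.
rewrite /radial_density indicE memNset ?mul0r ?mulr0//=.
by rewrite in_itv/= andbT; apply/negP; rewrite -leNgt (le_trans tb).
Qed.

Lemma measurable_sqnR m :
  measurable_fun setT (@sqn R m : _ -> measurableTypeR R).
Proof. exact: measurable_sqn. Qed.

(** Both sides are measures in [A]. They agree on the rays []-oo, t]], where the left side is a ball
    volume, hence by subtraction of finite values on the intervals []a, b]], which generate the
    Borel sets. *)
Lemma leb_sqn_preimage m (A : set R) : (0 < m)%N -> measurable A ->
  leb R m (@sqn R m @^-1` A) =
  (\int[mu]_(t in A) (radial_density R m t)%:E)%E.
Proof.
move=> m0 mA.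
pose nu := measure_function_pushforward__canonical__measure_function_Measure
  (leb R m) (measurable_sqnR m).
pose rho : {measure set (measurableTypeR R) -> \bar R} :=
  density_measure _ _ _ mu _
    (measurable_radial_density R m) (radial_density_ge0 R m).
have NE t : nu `]-oo, t]%classic = rho `]-oo, t]%classic.
  have -> : nu `]-oo, t]%classic = leb R m (sball R m t).
    by congr (leb R m _); apply/seteqP; split => y /=; rewrite in_itv.
  have [t0|t0] := leP t 0; first by rewrite leb_sball_le0// /rho /= /density
    radial_density_itvNy_le0.
  by rewrite leb_sballE// /rho /= /density radial_density_itvNy.
have Noo t : (nu `]-oo, t]%classic < +oo)%E.
  rewrite (@le_lt_trans _ _ (nu `]-oo, (Num.max t 1)]%classic))//.
    apply: le_measure; rewrite ?inE; [exact: measurable_itv..|].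
    by move=> x /=; rewrite !in_itv/= => /le_trans; apply; rewrite le_max lexx.
  have m1 : 0 < Num.max t 1 by rewrite lt_max ltr01 orbT.
  by rewrite NE /rho /= /density radial_density_itvNy// ltry.
have ocE a b : nu `]a, b]%classic = rho `]a, b]%classic.
  have [ab|ba] := ltP a b; last by rewrite set_itv_ge ?measure0// bnd_simp -leNgt.
  have abE : `]a, b]%classic = `]-oo, b] `\` `]-oo, a] :> set (measurableTypeR R).
    apply/seteqP; split => x /=; rewrite !in_itv/=.
      by move=> /andP[ax ->]; split => //; apply/negP; rewrite -ltNge.
    by move=> [-> /negP]; rewrite -ltNge => ->.
  have mNy c : measurable (`]-oo, c]%classic : set (measurableTypeR R)).
    exact: measurable_itv.
  have I : `]-oo, b] `&` `]-oo, a] = `]-oo, a]%classic :> set (measurableTypeR R).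
    apply/setIidPr => x /=; rewrite !in_itv/= => /le_trans; apply; exact: ltW.
  have rhooo : (rho `]-oo, b]%classic < +oo)%E by rewrite -NE.
  rewrite abE; apply: (etrans (measureD (mNy b) (mNy a) (Noo b))).
  apply/esym/(etrans (measureD (mNy b) (mNy a) rhooo)); rewrite I.
  by congr (_ - _)%E; apply/esym; exact: NE.
apply: (@measure_unique _ R (measurableTypeR R) (@ocitv R)
  (fun k => `](- k%:R), k%:R]%classic) _ _ _ _ nu rho _ _ A) => //.
- exact: ocitvI.
- by move=> k; exact: is_ocitv.
- rewrite -subTset => x _; exists (Num.truncn `|x|).+1 => //=.
  have := truncnS_gt `|x|; rewrite in_itv/= => /ltr_normlP[x1 x2].
  by rewrite (ltW x2) andbT ltrNl.
- by move=> _ [[a b] _ <-]; exact: ocE.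
- move=> k; apply: le_lt_trans (Noo k%:R).
  apply: le_measure; rewrite ?inE; [exact: measurable_itv..|].
  by move=> x /=; rewrite !in_itv/= => /andP[].
Qed.

Lemma ge0_integral_sqn m (G : R -> \bar R) : (0 < m)%N ->
  measurable_fun setT G -> (forall t, 0 <= G t)%E ->
  (\int[leb R m]_y G (sqn R y) =
   \int[mu]_t (G t * (radial_density R m t)%:E))%E.
Proof.
move=> m0 mG G0.
transitivity (\int[pushforward (leb R m) (@sqn R m : _ -> measurableTypeR R)]_t G t)%E.
  by rewrite (ge0_integral_pushforward (measurable_sqnR m)).
have <- := @ge0_integral_density _ _ _ mu _ (measurable_radial_density R m)
  (radial_density_ge0 R m) G mG G0.
pose nu := measure_function_pushforward__canonical__measure_function_Measure
  (leb R m) (measurable_sqnR m).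
apply: (@eq_measure_integral _ _ _ _ (density_measure _ _ _ mu _
  (measurable_radial_density R m) (radial_density_ge0 R m)) nu) => A mA _.
exact: leb_sqn_preimage.
Qed.

End PolarFormula.

(** * Zero sets of polynomials are null *)

Section PolynomialNullSet.
Variable R : realType.
Local Notation mu := (@lebesgue_measure R).

(** Polynomial in each coordinate separately, phrased by peeling off the first coordinate as [leb]
    does, so that the null set argument is an induction through Tonelli. *)
Fixpoint polyfun m : (m.-tuple R -> R) -> Prop :=
  match m return (m.-tuple R -> R) -> Prop with
  | 0 => fun _ => True
  | m'.+1 => fun f =>
      (forall t, exists p : {poly R}, forall x, f (cons_tuple x t) = p.[x]) /\
      (forall x, polyfun m' (fun t => f (cons_tuple x t)))
  end.

Lemma polyfun_cst m (c : R) : polyfun m (fun _ => c).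
Proof.
elim: m => //= m IH; split => // t.
by exists c%:P => x; rewrite hornerC.
Qed.

Lemma polyfunD m f g : polyfun m f -> polyfun m g ->
  polyfun m (fun y => f y + g y).
Proof.
elim: m f g => //= m IH f g [f1 f2] [g1 g2]; split => [t|x]; last exact: IH.
have [p pE] := f1 t; have [q qE] := g1 t.
by exists (p + q) => x; rewrite hornerD pE qE.
Qed.

Lemma polyfunM m f g : polyfun m f -> polyfun m g ->
  polyfun m (fun y => f y * g y).
Proof.
elim: m f g => //= m IH f g [f1 f2] [g1 g2]; split => [t|x]; last exact: IH.
have [p pE] := f1 t; have [q qE] := g1 t.
by exists (p * q) => x; rewrite hornerM pE qE.
Qed.

Lemma eq_polyfun m f g : f =1 g -> polyfun m f -> polyfun m g.
Proof. by move=> /funext ->. Qed.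

Lemma polyfun_tnth m i : polyfun m (fun y => tnth y i).
Proof.
elim: m i => //= m IH i; case: (unliftP ord0 i) => [j ->|->]; split => [t|x].
- by exists (tnth t j)%:P => x; rewrite tnthS hornerC.
- by apply: eq_polyfun (IH j) => t; rewrite tnthS.
- by exists 'X => x; rewrite tnth0 hornerX.
- by apply: eq_polyfun (polyfun_cst m x) => t; rewrite tnth0.
Qed.

Lemma polyfun_sum m (I : Type) (r : seq I) (f : I -> m.-tuple R -> R) :
  (forall i, polyfun m (f i)) -> polyfun m (fun y => \sum_(i <- r) f i y).
Proof.
move=> h; elim: r => [|i r IH].
  by apply: eq_polyfun (polyfun_cst m 0) => y; rewrite big_nil.
by apply: eq_polyfun (polyfunD _ _ _ (h i) IH) => y; rewrite big_cons.
Qed.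

Lemma polyfun_prod m (I : Type) (r : seq I) (f : I -> m.-tuple R -> R) :
  (forall i, polyfun m (f i)) -> polyfun m (fun y => \prod_(i <- r) f i y).
Proof.
move=> h; elim: r => [|i r IH].
  by apply: eq_polyfun (polyfun_cst m 1) => y; rewrite big_nil.
by apply: eq_polyfun (polyfunM _ _ _ (h i) IH) => y; rewrite big_cons.
Qed.

Lemma measurable_zero_set m (f : m.-tuple R -> R) : measurable_fun setT f ->
  measurable [set y | f y = 0].
Proof.
by move=> mf; rewrite -[X in measurable X]setTI; exact: (mf measurableT [set 0]).
Qed.

Lemma countable_poly_roots (p : {poly R}) : p != 0 ->
  countable [set x | p.[x] = 0].
Proof.
move=> p0; apply: finite_set_countable.
apply: (@sub_finite_set _ _ [set` (polyrcf.rootsR p)]); last exact: finite_seq.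
move=> x /= px; have := polyrcf.roots_on_rootsR p0 x.
by rewrite in_itv/= rootE px eqxx.
Qed.

(** Freeze the tail at that of [y0]: the resulting univariate polynomial is nonzero and has finitely
    many roots. For any other first coordinate the slice function is nonzero at this same tail, so
    its zero set is null by induction. *)
Lemma leb_polyfun_zero_set m (f : m.-tuple R -> R) (y0 : m.-tuple R) :
  polyfun m f -> measurable_fun setT f -> f y0 != 0 ->
  leb R m [set y | f y = 0] = 0%E.
Proof.
elim: m f y0 => [|m IH] f y0 pf mf fy0.
  rewrite /= indicE memNset//= => /eqP; apply/negP.
  by rewrite (_ : [tuple] = y0)//; apply/val_inj; rewrite (tuple0 y0).
case: pf => [p1 p2].
have [p pE] := p1 (behead_tuple y0).
have p0 : p != 0.
  apply: contraNneq fy0 => p0; apply/eqP.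
  by rewrite (tuple_eta y0) pE p0 horner0.
pose A := [set y | f y = 0].
have mA : measurable A by exact: measurable_zero_set.
have mc (x : R) : measurable_fun setT (fun t : m.-tuple R => cons_tuple x t).
  exact: measurable_cons.
have mI : measurable_fun setT (fun y => (\1_A y)%:E : \bar R).
  by apply/measurable_EFinP; exact: measurable_indic.
transitivity (\int[leb R m.+1]_y (\1_A y)%:E)%E.
  by rewrite integral_indic// setIT.
rewrite ge0_integral_lebS//.
rewrite -[RHS](@integral0 _ _ R mu setT).
apply: ae_eq_integral => //.
  by apply: (measurable_fun_inner_leb _ _ (fun y => (\1_A y)%:E)).
exists [set x | p.[x] = 0]; split.
- by apply: countable_measurable (countable_poly_roots _ p0) => t; exact: measurable_set1.
- exact: countable_lebesgue_measure0 (countable_poly_roots _ p0).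
move=> x /=; apply: contra_notP => px _.
transitivity (leb R m [set t | f (cons_tuple x t) = 0]).
  rewrite -[X in leb R m X]setIT -integral_indic//.
  by rewrite -[X in measurable X]setTI; exact: (mc x measurableT _ mA).
apply: (IH _ (behead_tuple y0)); [exact: p2| |by rewrite pE; exact/eqP].
exact: (measurableT_comp mf (mc x)).
Qed.

End PolynomialNullSet.

(** * Degenerate parameters *)

Section Degenerate.
Variables (R : realType) (n k : nat).
Hypothesis kn : (k.+1 <= n)%N.

Lemma pcoord_lt (j : 'I_k.+1) (i : 'I_n) : (j * n + i < k.+1 * n)%N.
Proof.
rewrite (@leq_trans (j.+1 * n))%N ?leq_mul2r ?ltn_ord ?orbT//.
by rewrite mulSn addnC ltn_add2r.
Qed.

Lemma pcoordE (q : (k.+1 * n).-tuple R) (j : 'I_k.+1) (i : 'I_n) :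
  pcoord R q j i = tnth q (Ordinal (pcoord_lt j i)).
Proof. by rewrite /pcoord (tnth_nth 0). Qed.

(** The first [k.+1] rows of the matrix whose columns are the [k] directions and the base vector. A
    nonzero determinant makes these columns independent, so the plane has dimension [k] and misses
    the origin. *)
Definition minor_mat (q : (k.+1 * n).-tuple R) : 'M[R]_k.+1 :=
  \matrix_(i < k.+1, j < k.+1) pcoord R q j i.

Lemma minor_matE q (i j : 'I_k.+1) : minor_mat q i j =
  tnth q (Ordinal (pcoord_lt j (widen_ord kn i))).
Proof. by rewrite mxE -pcoordE. Qed.

Lemma measurable_det_minor : measurable_fun setT (fun q => \det (minor_mat q)).
Proof.
have h i j : measurable_fun setT (fun q => minor_mat q i j).
  under eq_fun do rewrite minor_matE.
  exact: measurable_tnth.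
apply: measurable_sum => s; apply: measurable_funM => //.
by apply: measurable_prod => i _; exact: h.
Qed.

Lemma leb_degenerate :
  leb R (k.+1 * n) [set q | \det (minor_mat q) = 0] = 0%E.
Proof.
(* Position [j * n + i] holds coordinate [i] of block [j], so the blocks of this parameter are the
   first [k.+1] basis vectors and its minor is the identity. *)
pose q0 : (k.+1 * n).-tuple R :=
  [tuple ((i %/ n == i %% n)%N)%:R | i < k.+1 * n].
apply: (@leb_polyfun_zero_set _ _ _ q0).
- apply: polyfun_sum => s; apply: polyfunM; first exact: polyfun_cst.
  apply: polyfun_prod => i.
  by apply: eq_polyfun (polyfun_tnth R _ _) => q; rewrite minor_matE.
- exact: measurable_det_minor.
- rewrite (_ : minor_mat q0 = 1%:M) ?det1 ?oner_eq0//.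
  apply/matrixP => i j; rewrite minor_matE tnth_mktuple mxE /=.
  have n0 : (0 < n)%N by apply: leq_trans kn.
  have lin : (i < n)%N := leq_trans (ltn_ord i) kn.
  by rewrite divnMDl// modnMDl divn_small// addn0 modn_small// eq_sym.
Qed.

Lemma measurable_degenerate :
  measurable [set q : (k.+1 * n).-tuple R | \det (minor_mat q) = 0].
Proof. exact: measurable_zero_set measurable_det_minor. Qed.

End Degenerate.

(** * Orthonormal frames and the distance to the origin *)

Section Frames.
Variable R : realType.

Definition dotp {n} (u v : 'cV[R]_n) : R := (u^T *m v) 0 0.

Lemma dotpE n (u v : 'cV[R]_n) : dotp u v = \sum_i u i 0 * v i 0.
Proof. by rewrite /dotp mxE; apply: eq_bigr => i _; rewrite mxE. Qed.

Lemma dotp_ge0 n (u : 'cV[R]_n) : 0 <= dotp u u.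
Proof. by rewrite dotpE; apply: sumr_ge0 => i _; rewrite -expr2 sqr_ge0. Qed.

Lemma dotp_eq0 n (u : 'cV[R]_n) : dotp u u = 0 -> u = 0.
Proof.
rewrite dotpE => /eqP; rewrite psumr_eq0 => [|i _]; last by rewrite -expr2 sqr_ge0.
move=> /allP u0; apply/matrixP => i j; rewrite (ord1 j) mxE.
by have := u0 i (mem_index_enum i); rewrite /= mulf_eq0 orbb => /eqP.
Qed.

Lemma dotpD_orth n m (v : 'cV[R]_n) (U : 'M[R]_(n, m)) (z : 'cV[R]_m) :
  U^T *m U = 1%:M -> U^T *m v = 0 ->
  dotp (v + U *m z) (v + U *m z) = dotp v v + dotp z z.
Proof.
move=> UU Uv; rewrite /dotp.
have -> : (v + U *m z)^T = v^T + z^T *m U^T by rewrite linearD/= trmx_mul.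
rewrite mulmxDl !mulmxDr.
have vU : v^T *m U = 0 by rewrite -[LHS]trmxK trmx_mul trmxK Uv trmx0.
rewrite (mulmxA v^T) vU mul0mx addr0 -(mulmxA z^T U^T v) Uv mulmx0 add0r.
by rewrite -(mulmxA z^T) (mulmxA U^T) UU mul1mx mxE.
Qed.

(** Induction on the columns, orthogonalizing the first one against a frame of the others.
    Invertibility of [P] is what makes [B] and [U] have the same range. *)
Lemma gram_schmidt n m (B : 'M[R]_(n, m)) :
  (forall c : 'cV[R]_m, B *m c = 0 -> c = 0) ->
  exists (U : 'M[R]_(n, m)) (P : 'M[R]_m),
    [/\ U^T *m U = 1%:M, P \in unitmx & B = U *m P].
Proof.
(* Injectivity of [U *m P] forces [P] to be injective, hence invertible; [kermx] is a left kernel,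
   whence the transpose. *)
have unitP (l : nat) (A : 'M[R]_(n, l)) U (P : 'M[R]_l) : A = U *m P ->
    (forall c : 'cV[R]_l, A *m c = 0 -> c = 0) -> P \in unitmx.
  move=> AE A0; rewrite -unitmx_tr -row_free_unit; apply/row_freeP.
  suff : kermx P^T = 0.
    by move/eqP; rewrite kermx_eq0 => /row_freeP.
  apply/row_matrixP => i; rewrite row0; apply: (can_inj (@trmxK _ _ _)).
  rewrite trmx0; apply: A0; rewrite AE -mulmxA.
  suff -> : P *m (row i (kermx P^T))^T = 0 by rewrite mulmx0.
  by apply: (can_inj (@trmxK _ _ _)); rewrite trmx_mul trmxK -row_mul mulmx_ker
    row0 trmx0.
elim: m B => [|m IH] B B0.
  exists 0, 1%:M; split; rewrite ?unitmx1//; last by apply/matrixP => i [].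
  by apply/matrixP => -[].
move: B B0; rewrite -[m.+1]/(1 + m)%N => B B0.
pose b := lsubmx B; pose B' := rsubmx B.
have BE : B = row_mx b B' by rewrite hsubmxK.
have B'0 (c : 'cV[R]_m) : B' *m c = 0 -> c = 0.
  move=> h; have : col_mx (0 : 'cV_1) c = 0.
    by apply: B0; rewrite BE mul_row_col h mulmx0 addr0.
  by rewrite -[RHS](@col_mx0 _ 1 m) => /eq_col_mx[].
have [U [P [UU Pu B'E]]] := IH B' B'0.
pose v := b - U *m (U^T *m b).
have Uv : U^T *m v = 0 by rewrite mulmxBr !mulmxA UU mul1mx subrr.
have v0 : v != 0.
  (* If [v] vanished, [b] would be the combination of the other columns with coefficients
     [invmx P *m (U^T *m b)]. *)
  apply/eqP => /eqP; rewrite subr_eq0 => /eqP bE.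
  have : col_mx (1%:M : 'cV_1) (- (invmx P *m (U^T *m b))) = 0.
    apply: B0; rewrite BE mul_row_col mulmx1 mulmxN B'E.
    by rewrite -(mulmxA U) (mulmxA P) mulmxV// mul1mx -bE subrr.
  rewrite -[RHS](@col_mx0 _ 1 m) => /eq_col_mx[/matrixP/(_ 0 0) + _].
  by rewrite !mxE eqxx => /eqP; rewrite oner_eq0.
pose s := Num.sqrt (dotp v v).
have s0 : 0 < s.
  rewrite sqrtr_gt0 lt0r dotp_ge0 andbT; apply: contra v0 => /eqP h.
  exact/eqP/dotp_eq0.
have s2 : s ^+ 2 = dotp v v by rewrite sqr_sqrtr ?dotp_ge0.
pose V : 'M[R]_(n, 1 + m) := row_mx (s^-1 *: v) U.
pose Q : 'M[R]_(1 + m) := block_mx s%:M 0 (U^T *m b) P.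
have VQ : B = V *m Q.
  rewrite BE /V /Q mul_row_block mulmx0 add0r -B'E; congr row_mx.
  by rewrite mul_mx_scalar scalerA divff ?gt_eqF// scale1r /v subrK.
exists V, Q; split=> //; last exact: unitP VQ B0.
rewrite /V tr_row_mx mul_col_row UU.
have -> : (s^-1 *: v)^T *m (s^-1 *: v) = 1%:M.
  apply/matrixP => i j; rewrite (ord1 i) (ord1 j).
  have -> : (s^-1 *: v)^T = s^-1 *: v^T by apply/matrixP => l r; rewrite !mxE.
  rewrite -scalemxAl -scalemxAr scalerA !mxE eqxx.
  have := s2; rewrite /dotp mxE => <-.
  by rewrite -expr2 exprVn mulVf// expf_neq0// lt0r_neq0.
have -> : U^T *m (s^-1 *: v) = 0 by rewrite -scalemxAr Uv scaler0.
have -> : (s^-1 *: v)^T *m U = 0.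
  by rewrite -[LHS]trmxK trmx_mul trmxK -scalemxAr Uv scaler0 trmx0.
by rewrite -scalar_mx_block.
Qed.

Definition colt {n} (x : n.-tuple R) : 'cV[R]_n := \col_i tnth x i.
Definition tcol {n} (x : 'cV[R]_n) : n.-tuple R := [tuple x i 0 | i < n].

Lemma coltK n : cancel (@colt n) tcol.
Proof. by move=> x; apply: eq_from_tnth => i; rewrite tnth_mktuple mxE. Qed.

Lemma tcolK n : cancel (@tcol n) colt.
Proof. by move=> x; apply/matrixP => i j; rewrite (ord1 j) mxE tnth_mktuple. Qed.

Lemma sqn_colt n (x : n.-tuple R) : sqn R x = dotp (colt x) (colt x).
Proof. by rewrite dotpE; apply: eq_bigr => i _; rewrite mxE expr2. Qed.

Lemma colt_aff_pt n k x (U : 'M[R]_(n, k)) y :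
  colt (aff_pt R x U y) = colt x + U *m colt y.
Proof.
apply/matrixP => i j; rewrite !mxE tnth_mktuple; congr (_ + _).
by apply: eq_bigr => l _; rewrite mxE.
Qed.

Lemma colt_scale_shift k a (w y : k.-tuple R) :
  colt (scale_shift R k a w y) = a *: colt y + colt w.
Proof. by apply/matrixP => i j; rewrite !mxE tnth_mktuple. Qed.

Lemma range_aff_pt_eq n k x (A U : 'M[R]_(n, k)) (P : 'M[R]_k) :
  P \in unitmx -> A = U *m P -> range (aff_pt R x A) = range (aff_pt R x U).
Proof.
move=> Pu AE; apply/seteqP; split => _ [y _ <-].
  exists (tcol (P *m colt y)) => //; apply: (can_inj (@coltK n)).
  by rewrite !colt_aff_pt tcolK AE mulmxA.
exists (tcol (invmx P *m colt y)) => //; apply: (can_inj (@coltK n)).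
by rewrite !colt_aff_pt tcolK AE -mulmxA (mulmxA P) mulmxV// mul1mx.
Qed.

(** For orthonormal columns of [xU.2], the point of the plane nearest to the origin: the part of the
    base point orthogonal to the directions. *)
Definition foot n k (xU : n.-tuple R * 'M[R]_(n, k)) : 'cV[R]_n :=
  colt xU.1 - xU.2 *m (xU.2^T *m colt xU.1).

(** Pythagoras for the splitting of a point of the plane into [foot] and a vector of the direction
    space. *)
Lemma frame_sqn n k (xU : n.-tuple R * 'M[R]_(n, k)) y :
  xU.2^T *m xU.2 = 1%:M ->
  sqn R (aff_pt R xU.1 xU.2 y) = dotp (foot n k xU) (foot n k xU) +
    sqn R (scale_shift R k 1 (tcol (xU.2^T *m colt xU.1)) y).
Proof.
move=> UU; rewrite !sqn_colt colt_scale_shift scale1r tcolK colt_aff_pt.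
rewrite -(dotpD_orth _ _ _ xU.2)//; last by rewrite mulmxBr !mulmxA UU mul1mx subrr.
suff -> : foot n k xU + xU.2 *m (colt y + xU.2^T *m colt xU.1) =
  colt xU.1 + xU.2 *m colt y by [].
by rewrite mulmxDr addrCA /foot subrK addrC.
Qed.

Lemma dist0_frame n k xi (xU : n.-tuple R * 'M[R]_(n, k)) :
  is_frame R k xi xU ->
  dist0 R xi = Num.sqrt (dotp (foot n k xU) (foot n k xU)).
Proof.
move=> [UU ->]; set w := tcol (xU.2^T *m colt xU.1).
have lb : lbound [set enorm R z | z in range (aff_pt R xU.1 xU.2)]
    (Num.sqrt (dotp (foot n k xU) (foot n k xU))).
  move=> _ [_ [y _ <-] <-]; rewrite enormE frame_sqn// ler_wsqrtr// lerDl.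
  exact: sqn_ge0.
apply/eqP; rewrite eq_le; apply/andP; split; last first.
  apply: lb_le_inf => //; exists (enorm R (aff_pt R xU.1 xU.2 w)).
  by exists (aff_pt R xU.1 xU.2 w) => //; exists w.
apply: ge_inf; first by eexists; exact: lb.
(* These coordinates cancel the translation, so this point is the foot and the infimum is
   attained. *)
exists (aff_pt R xU.1 xU.2 (tcol (- colt w))).
  by eexists.
rewrite enormE frame_sqn//; congr Num.sqrt.
rewrite [X in _ + X](_ : _ = 0) ?addr0//.
rewrite sqn_colt colt_scale_shift -/w scale1r tcolK addNr.
by rewrite dotpE big1// => i _; rewrite mxE mul0r.
Qed.

Section Nondegenerate.
Variables (n k : nat) (q : (k.+1 * n).-tuple R).
Hypothesis kn : (k.+1 <= n)%N.
Hypothesis q0 : \det (minor_mat R n k q) != 0.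

Lemma param_free (c : 'cV[R]_k) (d : R) :
  param_mat R q *m c + d *: colt (param_vec R q) = 0 -> c = 0 /\ d = 0.
Proof.
move=> h.
(* The linear relation as a single vector, with the coefficient of the base vector in the last slot;
   the minor annihilates it. *)
pose c' : 'cV[R]_k.+1 := \col_j (if unlift ord_max j is Some l then c l 0 else d).
have : minor_mat R n k q *m c' = 0.
  apply/matrixP => i j; rewrite (ord1 j) !mxE big_ord_recr/=.
  have /matrixP/(_ (widen_ord kn i) 0) := h; rewrite !mxE tnth_mktuple => hi; apply: etrans hi.
  congr (_ + _); last by rewrite ?mxE unlift_none mulrC.
  apply: eq_bigr => l _; rewrite !mxE.
  have -> : widen_ord (leqnSn k) l = lift ord_max l.
    by apply/val_inj; rewrite [RHS]lift_max.
  by rewrite liftK lift_max.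
move=> /(congr1 (mulmx (invmx (minor_mat R n k q)))).
rewrite mulmx0 mulmxA mulVmx ?unitmxE ?unitfE// mul1mx => c'0; split.
  apply/matrixP => l j; rewrite (ord1 j) [RHS]mxE.
  by have /matrixP/(_ (lift ord_max l) 0) := c'0; rewrite !mxE liftK.
by have /matrixP/(_ ord_max 0) := c'0; rewrite !mxE unlift_none.
Qed.

(** [epsilon] returns an arbitrary value unless some frame exists; Gram-Schmidt applied to the
    independent directions provides one. *)
Lemma is_frame_plane_of : is_frame R k (plane_of R q) (frame R k (plane_of R q)).
Proof.
rewrite /frame; apply: ClassicalEpsilon.epsilon_spec.
have [|U [P [UU Pu AE]]] := gram_schmidt _ _ (param_mat R q).
  move=> c h; have [] := param_free c 0; rewrite ?scale0r ?addr0//.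
exists (param_vec R q, U); split => //=.
exact: range_aff_pt_eq Pu AE.
Qed.

Lemma dist0_plane_of_gt0 : 0 < dist0 R (plane_of R q).
Proof.
have h := is_frame_plane_of; rewrite (dist0_frame _ _ _ _ h).
set F := frame R k _ in h *; case: h => UU PE.
rewrite sqrtr_gt0 lt0r dotp_ge0 andbT; apply/eqP => /dotp_eq0 foot0.
(* Otherwise the origin would lie on the plane. *)
have : plane_of R q (tcol 0).
  rewrite PE; exists (tcol (- (F.2^T *m colt F.1))) => //.
  apply: (can_inj (@coltK n)); rewrite colt_aff_pt !tcolK mulmxN.
  exact: foot0.
move=> [y _ /(congr1 colt)]; rewrite tcolK colt_aff_pt addrC => yE.
have [] := param_free (colt y) 1; first by rewrite scale1r.
by move=> _ /eqP; rewrite oner_eq0.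
Qed.

End Nondegenerate.

(** Scaling the whole parameter scales directions and base vector alike, so the plane is replaced by
    its image under the dilation of the ambient space. *)
Lemma dist0_dilate n k (q : (k.+1 * n).-tuple R) (a : R) : 0 < a ->
  dist0 R (plane_of R (dilate R _ a q)) = a * dist0 R (plane_of R q).
Proof.
move=> a0.
(* Stated for all naturals [j] and [i], so it also covers the default value 0 of [nth], which
   scaling fixes. *)
have pE j i : pcoord R (dilate R (k.+1 * n) a q) j i = a * pcoord R q j i.
  rewrite /pcoord; have [h|h] := ltnP (j * n + i) (k.+1 * n).
    by rewrite -!(tnth_nth 0 _ (Ordinal h)) !tnth_mktuple addr0.
  by rewrite !nth_default ?mulr0// size_tuple.
have aff y : colt (aff_pt R (param_vec R (dilate R _ a q))
    (param_mat R (dilate R _ a q)) y) =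
    a *: colt (aff_pt R (param_vec R q) (param_mat R q) y).
  rewrite !colt_aff_pt scalerDr; congr (_ + _).
    by apply/matrixP => i j; rewrite !mxE !tnth_mktuple pE.
  rewrite scalemxAl; congr (_ *m _).
  by apply/matrixP => i j; rewrite !mxE pE.
have enormZ (x y : n.-tuple R) : colt x = a *: colt y ->
    enorm R x = a * enorm R y.
  move=> h; rewrite !enormE !sqn_colt h !dotpE.
  rewrite -[a in RHS]ger0_norm ?(ltW a0)// -sqrtr_sqr -sqrtrM ?sqr_ge0//.
  congr Num.sqrt; rewrite mulr_sumr; apply: eq_bigr => i _; rewrite !mxE; ring.
pose S := [set enorm R z | z in plane_of R q].
have S0 : S !=set0.
  exists (enorm R (aff_pt R (param_vec R q) (param_mat R q) (tcol 0))).
  by eexists; [exists (tcol 0)|].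
have lbS : has_lbound S.
  by exists 0 => _ [z _ <-]; exact: sqrtr_ge0.
have -> : dist0 R (plane_of R (dilate R (k.+1 * n) a q)) =
    inf [set a * s | s in S].
  congr inf; apply/seteqP; split.
    move=> _ [_ [y _ <-] <-]; exists (enorm R (aff_pt R (param_vec R q) (param_mat R q) y)).
      by eexists; [exists y|].
    by rewrite -(enormZ _ _ (aff y)).
  move=> _ [_ [_ [y _ <-] <-] <-]; rewrite -(enormZ _ _ (aff y)).
  by eexists; [exists y|].
apply/eqP; rewrite eq_le; apply/andP; split.
  rewrite mulrC -ler_pdivrMr//; apply: lb_le_inf => // s Ss.
  rewrite ler_pdivrMr// mulrC; apply: ge_inf; last by exists s.
  by exists 0 => _ [_ [z _ <-] <-]; rewrite mulr_ge0 ?sqrtr_ge0// ltW.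
apply: lb_le_inf; first by case: S0 => s Ss; exists (a * s); exists s.
by move=> _ [s Ss <-]; rewrite ler_pM2l//; exact: ge_inf.
Qed.

End Frames.

(** * Radial functions and their profiles *)

Section RadialProfile.
Variable R : realType.
Local Notation mu := (@lebesgue_measure R).

Definition axis_pt n (s : R) : n.-tuple R :=
  [tuple if (i : nat) == 0%N then s else 0 | i < n].

(** The function of [|x|^2] behind a radial [f], read off on the first axis so that it inherits
    measurability from [f]. *)
Definition profile n (f : n.-tuple R -> R) (t : R) : R :=
  f (axis_pt n (t `^ 2^-1)).

Lemma measurable_profile n (f : n.-tuple R -> R) :
  measurable_fun setT f -> measurable_fun setT (profile n f).
Proof.
move=> mf; apply: (measurableT_comp mf); apply/measurable_fun_tnthP => i.
rewrite (_ : _ \o _ = fun t => if (i : nat) == 0%N then t `^ 2^-1 else 0).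
  by case: (_ == _); [exact: measurable_powR|exact: measurable_cst].
by apply/funext => t; rewrite /= tnth_mktuple.
Qed.

Lemma enorm_powR m (x : m.-tuple R) (a : R) :
  enorm R x `^ a = sqn R x `^ (a / 2).
Proof. by rewrite enormE -powR12_sqrt ?sqn_ge0// -powRrM mulrC. Qed.

Lemma profileE n (f : n.-tuple R -> R) : (0 < n)%N -> radial R f ->
  forall x, f x = profile n f (sqn R x).
Proof.
move=> n0 rf x; apply: rf; rewrite !enormE; congr Num.sqrt.
rewrite -/(sqn R x) -/(sqn R (axis_pt n (sqn R x `^ 2^-1))).
rewrite [RHS]/sqn [RHS](bigD1 (Ordinal n0))// [in RHS]tnth_mktuple/=.
rewrite [X in _ = _ + X]big1 => [|i].
  by rewrite addr0 powR12_sqrt ?sqr_sqrtr ?sqn_ge0.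
move=> i0; rewrite tnth_mktuple ifF ?expr0n//; apply/negbTE.
by apply: contra i0 => /eqP i0; apply/eqP/val_inj.
Qed.

Lemma measurable_comp_sqn m (G : R -> \bar R) : measurable_fun setT G ->
  measurable_fun setT (fun y : m.-tuple R => G (sqn R y)).
Proof. by move=> mG; apply: (measurableT_comp mG); exact: measurable_sqn. Qed.

Lemma measurable_comp_affine (G : R -> \bar R) (a b : R) : measurable_fun setT G ->
  measurable_fun setT (fun t : R => G (a * t + b)).
Proof.
move=> mG; apply: (measurableT_comp mG).
by apply: measurable_funD => //; apply: measurable_funM.
Qed.

(** Translation invariance absorbs the shift in [frame_sqn]. The factor [1 *] keeps the argument in
    the form [a * t + b] of the affine lemmas. *)
Lemma ge0_integral_frame n k (xU : n.-tuple R * 'M[R]_(n, k)) (G : R -> \bar R) :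
  xU.2^T *m xU.2 = 1%:M -> measurable_fun setT G -> (forall t, 0 <= G t)%E ->
  (\int[leb R k]_y G (sqn R (aff_pt R xU.1 xU.2 y)) =
   \int[leb R k]_y G (1 * sqn R y + dotp R (foot R n k xU) (foot R n k xU))%R)%E.
Proof.
move=> UU mG G0.
under eq_integral do rewrite frame_sqn// addrC -[X in G (X + _)]mul1r.
rewrite (ge0_integral_leb_affine _ _ _ _ (fun y => G (1 * sqn R y +
  dotp R (foot R n k xU) (foot R n k xU))%R))//.
  by rewrite invr1 expr1n mul1e.
apply: (measurable_comp_sqn k (fun t => G (1 * t + _)%R)).
exact: measurable_comp_affine.
Qed.

Lemma ge0_integral_sqn_scale m (G : R -> \bar R) (r : R) :
  0 < r -> measurable_fun setT G -> (forall t, 0 <= G t)%E ->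
  (\int[leb R m]_y G (sqn R y) =
   (r ^+ m)%:E * \int[leb R m]_y G (r ^+ 2 * sqn R y)%R)%E.
Proof.
move=> r0 mG G0.
under [X in (_ * X)%E]eq_integral do rewrite -sqn_dilate.
rewrite (ge0_integral_leb_affine _ _ _ _ (fun y => G (sqn R y)))//.
  by rewrite muleA -EFinM -exprMn divff ?gt_eqF// expr1n mul1e.
exact: measurable_comp_sqn.
Qed.

End RadialProfile.

(** * The kernel at distance 1 and its dual norm *)

Section Kernel.
Variable R : realType.
Local Notation mu := (@lebesgue_measure R).
Variables (k : nat) (p d : R).
Hypotheses (k1 : (1 <= k)%N) (p1 : 1 <= p) (d0 : 0 < d).
(* With d = (n + alpha) / 2 - 1 this is the condition p < (alpha + n) / k. *)
Hypothesis dk : k%:R * p < 2 * (d + 1).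
Hypothesis kp : (2 <= k)%N \/ 2 < p.

(** At distance 1 the plane integral pairs [g (1 + s)] with [s^(k/2 - 1)]. Moving a factor
    [(1 + s)^(d/p)] to [g] makes its [p]-th power carry the weight of the norm, and this kernel is
    what remains. *)
Definition kern (s : R) : R :=
  \1_(`]0, +oo[%classic) s * (s `^ (k%:R / 2 - 1) * (1 + s) `^ (- (d / p))).

Lemma measurable_kern : measurable_fun setT kern.
Proof.
apply: measurable_funM => //; apply: measurable_funM; first exact: measurable_powR.
apply: (@measurableT_comp _ _ _ _ _ _ (@powR R ^~ _)); first exact: measurable_powR.
exact: measurable_funD.
Qed.

Lemma kern_ge0 s : 0 <= kern s.
Proof. by rewrite mulr_ge0 ?mulr_ge0 ?powR_ge0// indicE. Qed.

(** For [p = 1] the dual exponent is infinite. Here [k >= 2], so [s^(k/2 - 1)] is at most the same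
    power of [1 + s], and [k/2 - 1] is less than [d]. *)
Lemma kern_le1 s : p = 1 -> kern s <= 1.
Proof.
move=> p1'; have k2 : 2 <= k%:R :> R by rewrite ler_nat; case: kp => //; rewrite p1'; lra.
rewrite /kern indicE p1' divr1; have [|_] := boolP (s \in _); last by rewrite mul0r.
rewrite inE/= in_itv/= andbT mul1r => s0.
have s1 : 1 <= 1 + s by lra.
apply: (@le_trans _ _ ((1 + s) `^ d * (1 + s) `^ (- d))); last first.
  by rewrite -powRD ?subrr ?powRr0// eqxx/=; apply/eqP; lra.
rewrite ler_wpM2r ?powR_ge0//.
apply: (@le_trans _ _ ((1 + s) `^ (k%:R / 2 - 1))).
  by apply: ge0_ler_powR; rewrite ?nnegrE; lra.
by apply: ler_powR => //; move: dk; rewrite p1'; lra.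
Qed.

Lemma kern_powR_lty (q : R) : 1 < p -> q = p / (p - 1) ->
  (\int[mu]_s (kern s `^ q)%:E < +oo)%E.
Proof.
move=> p1' qE.
have p0 : 0 < p - 1 by lra.
have q0 : 0 < q by rewrite qE divr_gt0//; lra.
have k0 : 1 <= k%:R :> R by rewrite ler1n.
(* [kern^q] behaves like [s^(a - 1)] at 0 and like [s^(- b - 1)] at infinity. Multiplied by [p - 1],
   the numbers [a] and [b] become [k p / 2 - 1] and [d + 1 - k p / 2], so both integrability
   conditions bear on [k p]. *)
pose a := (k%:R / 2 - 1) * q + 1; pose b := d / p * q - (k%:R / 2 - 1) * q - 1.
have kp2 : 2 < k%:R * p.
  case: kp => [k2|p2]; last by apply: (lt_le_trans p2); rewrite ler_peMl//; lra.
  have : 2 <= k%:R :> R by rewrite ler_nat.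
  by move=> h; nra.
have a0 : 0 < a.
  have -> : a = (k%:R * p / 2 - 1) / (p - 1) by rewrite /a qE; field; lra.
  by rewrite divr_gt0//; lra.
have b0 : 0 < b.
  have -> : b = (d + 1 - k%:R * p / 2) / (p - 1) by rewrite /b qE; field; lra.
  by rewrite divr_gt0//; move: dk; lra.
pose h1 := (fun s : R => (s `^ (a - 1))%:E) \_ (`]0, 1]%classic : set R).
pose h2 := (fun s : R => (s `^ (- b - 1))%:E) \_ (`[1, +oo[%classic : set R).
have mpow (e : R) : measurable_fun setT (fun s : R => (s `^ e)%:E).
  by apply/measurable_EFinP; exact: measurable_powR.
have h1_ge0 s : (0 <= h1 s)%E.
  by rewrite /h1 patchE; case: ifP => // _; rewrite lee_fin powR_ge0.
have h2_ge0 s : (0 <= h2 s)%E.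
  by rewrite /h2 patchE; case: ifP => // _; rewrite lee_fin powR_ge0.
have mh1 : measurable_fun setT h1.
  by apply/(measurable_restrictT _ _).1; [exact: measurable_itv|exact: measurable_funTS].
have mh2 : measurable_fun setT h2.
  by apply/(measurable_restrictT _ _).1; [exact: measurable_itv|exact: measurable_funTS].
apply: (@le_lt_trans _ _ (\int[mu]_s (h1 s + h2 s))%E); last first.
  rewrite ge0_integralD// lte_add_pinfty//.
    by rewrite -integral_mkcond integral_powR_itv0// ltry.
  rewrite -integral_mkcond; apply: le_lt_trans (integral_powR_itvy _ _ _ b0 ltr01) _.
  exact: ltry.
apply: ge0_le_integral => //.
- by move=> s _; rewrite lee_fin powR_ge0.
- apply/measurable_EFinP; apply: (@measurableT_comp _ _ _ _ _ _ (@powR R ^~ q)).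
    exact: measurable_powR.
  exact: measurable_kern.
- exact: emeasurable_funD.
move=> s _; have [s0|s0] := leP s 0.
  rewrite /kern indicE memNset/=; last first.
    by rewrite in_itv/= andbT; apply/negP; rewrite -leNgt.
  by rewrite mul0r powR0 ?gt_eqF// adde_ge0.
have kE : kern s `^ q = s `^ (a - 1) * (1 + s) `^ (- (d / p * q)).
  rewrite /kern indicE mem_set ?mul1r; last by rewrite /= in_itv/= s0.
  rewrite powRM ?powR_ge0// -!powRrM; congr (_ `^ _ * _ `^ _); last by rewrite mulNr.
  by rewrite /a addrK.
have dpq : 0 <= d / p * q by rewrite !mulr_ge0 ?invr_ge0 ?(ltW d0) ?(ltW q0)//; lra.
have s10 : 0 < 1 + s by lra.
rewrite kE; have [s1|s1] := leP s 1.
  apply: (@le_trans _ _ (h1 s)); last by rewrite leeDl.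
  rewrite /h1 patchE mem_set/=; last by rewrite in_itv/= s0.
  rewrite lee_fin ger_pMr ?powR_gt0// powRN invf_le1 ?powR_gt0//.
  apply: (@le_trans _ _ ((1 + s) `^ 0)); first by rewrite powRr0.
  by apply: ler_powR => //; lra.
apply: (@le_trans _ _ (h2 s)); last by rewrite leeDr.
rewrite /h2 patchE mem_set/=; last by rewrite in_itv/= ltW.
have -> : - b - 1 = (a - 1) + - (d / p * q) by rewrite /a /b; ring.
rewrite lee_fin (@powRD _ s (a - 1) (- (d / p * q))); last by apply/implyP => _; rewrite gt_eqF.
rewrite ler_wpM2l ?powR_ge0// !powRN lef_pV2 ?posrE ?powR_gt0//.
by apply: ge0_ler_powR; rewrite ?nnegrE//; lra.
Qed.

Lemma kern_hoelder : exists2 B : R, 0 <= B &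
  forall F : R -> R, measurable_fun setT F ->
    (\int[mu]_s (`|F s| * kern s)%:E <=
     B%:E * (\int[mu]_s (`|F s| `^ p)%:E) `^ p^-1)%E.
Proof.
have [p1'|p1'] := eqVneq p 1.
  exists 1 => // F mF; rewrite p1' invr1 mul1e.
  under [X in (_ <= X `^ _)%E]eq_integral do rewrite powRr1//.
  have mF' : measurable_fun setT (fun s => (`|F s|)%:E).
    by apply/measurable_EFinP; exact: measurableT_comp.
  rewrite poweRe1; last by apply: integral_ge0 => s _; rewrite lee_fin.
  apply: ge0_le_integral => //.
  - by move=> s _; rewrite lee_fin mulr_ge0// kern_ge0.
  - apply/measurable_EFinP/measurable_funM; last exact: measurable_kern.
    exact: measurableT_comp.
  - by move=> s _; rewrite lee_fin ler_piMr// kern_le1.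
have {}p1' : 1 < p by rewrite lt_neqAle eq_sym p1'.
pose q := p / (p - 1).
have q0 : 0 < q by rewrite divr_gt0//; lra.
have pq : p^-1 + q^-1 = 1 by rewrite /q; field; lra.
have p0 : 0 < p by lra.
have Klty := kern_powR_lty q p1' erefl.
pose B := fine ((\int[mu]_s (kern s `^ q)%:E) `^ q^-1)%E.
have BE : (B%:E = (\int[mu]_s (kern s `^ q)%:E) `^ q^-1)%E.
  by rewrite fineK// ge0_fin_numE ?poweR_ge0// poweR_lty.
exists B; first by rewrite fine_ge0// poweR_ge0.
move=> F mF.
have := @hoelder _ _ R mu F kern p q mF measurable_kern p0 q0 pq.
rewrite Lnorm1 Lnorm.unlock /= BE muleC.
congr (_ <= _ * _)%E.
- by apply: eq_integral => s _; rewrite /= normrM (ger0_norm (kern_ge0 s)).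
- by congr (_ `^ _)%E; apply: eq_integral => s _; rewrite /= (ger0_norm (kern_ge0 s)).
Qed.

End Kernel.

(** * The bound on a plane at given distance *)

Section Sufficiency.
Variable R : realType.
Local Notation mu := (@lebesgue_measure R).
Variables (n k : nat) (alpha p : R).
Hypotheses (n1 : (1 <= n)%N) (k1 : (1 <= k)%N) (p1 : 1 <= p).
Hypothesis pk : k%:R * p < alpha + n%:R.
Hypothesis kp : (2 <= k)%N \/ 2 < p.

(** The [p]-th power of the weighted norm of the radial function with profile [g >= 0], kept in the
    extended reals so that estimates precede finiteness. *)
Definition wint (g : R -> R) : \bar R :=
  (\int[leb R n]_x (g (sqn R x) `^ p * enorm R x `^ alpha)%:E)%E.

Let G2 (g : R -> R) (t : R) : \bar R := (g t `^ p * t `^ (alpha / 2))%:E.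

Let mG2 g : measurable_fun setT g -> measurable_fun setT (G2 g).
Proof.
move=> mg; apply/measurable_EFinP/measurable_funM; last exact: measurable_powR.
by apply: (@measurableT_comp _ _ _ _ _ _ (@powR R ^~ p)); first exact: measurable_powR.
Qed.

Let G2_ge0 g t : (0 <= G2 g t)%E.
Proof. by rewrite lee_fin mulr_ge0 ?powR_ge0. Qed.

Lemma wintE g : wint g = (\int[leb R n]_x G2 g (sqn R x))%E.
Proof. by apply: eq_integral => x _; rewrite enorm_powR. Qed.

Lemma wint_ge0 g : (0 <= wint g)%E.
Proof. by apply: integral_ge0 => x _; rewrite lee_fin mulr_ge0 ?powR_ge0. Qed.

(** This homogeneity of degree [alpha + n] determines the exponent of the distance, in both
    directions of the theorem. *)
Lemma wint_scale g r : measurable_fun setT g -> 0 < r ->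
  wint g = ((r `^ (alpha + n%:R))%:E * wint (fun t => g (r ^+ 2 * t)%R))%E.
Proof.
move=> mg r0; pose gr t := g (r ^+ 2 * t).
have mgr : measurable_fun setT gr.
  by apply: (measurableT_comp mg); exact: measurable_funM.
rewrite !wintE (ge0_integral_sqn_scale _ _ _ _ r0 (mG2 g mg) (G2_ge0 g)).
rewrite addrC powRD; last by apply/implyP => _; rewrite gt_eqF.
rewrite EFinM -muleA powR_mulrn ?(ltW r0)//; congr (_ * _)%E.
rewrite -ge0_integralZl_EFin ?powR_ge0//; last first.
  exact: measurable_comp_sqn (mG2 gr mgr).
apply: eq_integral => x _; rewrite /G2 -EFinM; congr EFin.
rewrite mulrCA; congr (_ * _).
rewrite powRM ?sqn_ge0 ?sqr_ge0// -powR_mulrn ?(ltW r0)// -powRrM.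
by congr (_ `^ _ * _); field.
Qed.

Lemma wint_polar g : (0 < n)%N -> measurable_fun setT g ->
  wint g = (\int[mu]_t
    (g t `^ p * t `^ (alpha / 2) * radial_density R n t)%:E)%E.
Proof.
move=> n0 mg; rewrite wintE (ge0_integral_sqn _ _ (G2 g))//; last exact: mG2.
Qed.

Lemma plane_bound1 : exists2 C : R, 0 <= C &
  forall g : R -> R, measurable_fun setT g -> (forall t, 0 <= g t) ->
    (\int[leb R k]_y (g (1 * sqn R y + 1))%:E <= C%:E * wint g `^ p^-1)%E.
Proof.
pose d := (alpha + n%:R) / 2 - 1.
have p0 : 0 < p by apply: lt_le_trans p1.
have kp2 : 2 <= k%:R * p.
  have k1R : 1 <= k%:R :> R by rewrite ler1n.
  case: kp => [k2|p2].
    have k2R : 2 <= k%:R :> R by rewrite ler_nat.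
    by rewrite (le_trans k2R)// ler_peMr//; exact: le_trans k2R.
  by rewrite (le_trans (ltW p2))// ler_peMl// ltW.
have d0 : 0 < d by rewrite /d; move: pk; lra.
have dk : k%:R * p < 2 * (d + 1) by rewrite /d; move: pk; lra.
have [B B0 HB] := kern_hoelder R k p d k1 p1 d0 dk kp.
pose ck : R := k%:R / 2 * ball_vol R k; pose cn : R := n%:R / 2 * ball_vol R n.
have ck0 : 0 < ck by rewrite mulr_gt0 ?divr_gt0 ?ltr0n// ball_vol_gt0.
have cn0 : 0 < cn by rewrite mulr_gt0 ?divr_gt0 ?ltr0n// ball_vol_gt0.
(* [ck] comes from the radial density on the plane; dividing by [cn] compares the one-dimensional
   integral with the norm on the whole space. *)
exists (ck * (B * cn^-1 `^ p^-1)).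
  by rewrite mulr_ge0 ?(ltW ck0)// mulr_ge0// powR_ge0.
move=> g mg g0.
pose F s := \1_(`]0, +oo[%classic) s * (g (1 * s + 1) * (1 + s) `^ (d / p)).
have mg1 : measurable_fun setT (fun s : R => g (1 * s + 1)).
  apply: (measurableT_comp mg).
  by apply: measurable_funD => //; apply: measurable_funM.
have mF : measurable_fun setT F.
  apply: measurable_funM => //; apply: measurable_funM => //.
  apply: (@measurableT_comp _ _ _ _ _ _ (@powR R ^~ _)); first exact: measurable_powR.
  exact: measurable_funD.
have F0 s : 0 <= F s by rewrite !mulr_ge0 ?powR_ge0// indicE.
rewrite (ge0_integral_sqn _ _ (fun t => (g (1 * t + 1))%:E))//; last 2 first.
- exact/measurable_EFinP.
- by move=> t; rewrite lee_fin.
rewrite (_ : (\int[mu]_t _ = ck%:E * \int[mu]_s (`|F s| * kern R k p d s)%:E)%E);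
    last first.
  rewrite -ge0_integralZl_EFin//; last 3 first.
  - by move=> s _; rewrite lee_fin mulr_ge0// kern_ge0.
  - apply/measurable_EFinP/measurable_funM; last exact: measurable_kern.
    exact: measurableT_comp.
  - exact: ltW.
  apply: eq_integral => s _; rewrite ger0_norm// -!EFinM; congr EFin.
  rewrite /F /kern /radial_density -/ck indicE.
  have [|_] := boolP (s \in _); last by rewrite !mul0r !mulr0.
  rewrite inE/= in_itv/= andbT => s0; rewrite !mul1r powRN.
  by field; rewrite powR_eq0 negb_and; apply/orP; left; lra.
rewrite (EFinM ck) -[leRHS]muleA; apply: lee_wpmul2l; first by rewrite lee_fin ltW.
apply: le_trans (HB F mF) _; rewrite (EFinM B) -[leRHS]muleA.
apply: lee_wpmul2l; first by rewrite lee_fin.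
rewrite -poweR_EFin -poweRM ?wint_ge0//; last by rewrite lee_fin invr_ge0 ltW.
apply: gt0_ler_poweR.
- by rewrite invr_ge0 ltW.
- rewrite in_itv/= leey andbT; apply: integral_ge0 => s _.
  by rewrite lee_fin powR_ge0.
- by rewrite in_itv/= leey andbT mule_ge0 ?wint_ge0// lee_fin invr_ge0 ltW.
rewrite muleC lee_pdivlMr// muleC wintE.
rewrite (ge0_integral_sqn _ _ (G2 g))//; last exact: mG2.
pose H t := (G2 g t * (radial_density R n t)%:E)%E.
have mH : measurable_fun setT H.
  apply: emeasurable_funM; first exact: mG2.
  by apply/measurable_EFinP; exact: measurable_radial_density.
have H0 t : (0 <= H t)%E.
  by apply: mule_ge0; [exact: G2_ge0|rewrite lee_fin radial_density_ge0].
(* [s] is the squared distance from the foot and [t = s + 1] the squared norm; [F] lives on [s > 0],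
   so the part of the norm inside the unit ball is dropped. *)
have -> : (\int[mu]_t H t = \int[mu]_s H (1 * s + 1)%R)%E.
  by rewrite (ge0_integral_affine _ _ _ _ ltr01 mH H0) invr1 mul1e.
have mFp : measurable_fun setT (fun s : R => (`|F s| `^ p)%:E).
  apply/measurable_EFinP.
  apply: (@measurableT_comp _ _ _ _ _ _ (@powR R ^~ p)); first exact: measurable_powR.
  exact: measurableT_comp.
rewrite -ge0_integralZl_EFin//; last exact: ltW.
apply: ge0_le_integral => //.
- by move=> s _; rewrite -EFinM lee_fin mulr_ge0 ?powR_ge0// ltW.
- by apply: emeasurable_funM => //; exact: measurable_cst.
- exact: measurable_comp_affine.
move=> s _; have [s0|s0] := leP s 0.
  rewrite /F indicE memNset/=; last first.
    by rewrite in_itv/= andbT; apply/negP; rewrite -leNgt.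
  by rewrite mul0r normr0 powR0 ?gt_eqF// mule0.
have s10 : 0 < 1 + s by lra.
rewrite ger0_norm// /F indicE mem_set/= ?mul1r; last by rewrite in_itv/= s0.
rewrite powRM ?powR_ge0// -powRrM divfK ?gt_eqF//.
rewrite /H /G2 /radial_density -/cn indicE mem_set/=; last first.
  by rewrite in_itv/= andbT; lra.
rewrite -!EFinM lee_fin mul1r (addrC s 1).
have -> : d = alpha / 2 + (n%:R / 2 - 1) by rewrite /d; lra.
rewrite powRD; last by apply/implyP => _; rewrite gt_eqF.
by rewrite le_eqVlt; apply/orP; left; apply/eqP; ring.
Qed.

(** Dilation to distance 1: the measure on the plane contributes [r^k], and the homogeneity of
    [wint], raised to [1 / p], contributes [r^(- (alpha + n) / p)]. *)
Lemma plane_bound : exists2 C : R, 0 <= C &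
  forall (g : R -> R) (r : R), measurable_fun setT g -> (forall t, 0 <= g t) ->
    0 < r ->
    (\int[leb R k]_y (g (1 * sqn R y + r ^+ 2))%:E <=
     (C * r `^ (k%:R - (alpha + n%:R) / p))%:E * wint g `^ p^-1)%E.
Proof.
have [C C0 HC] := plane_bound1; exists C => // g r mg g0 r0.
pose gr t := g (r ^+ 2 * t).
have mgr : measurable_fun setT gr.
  by apply: (measurableT_comp mg); exact: measurable_funM.
have r2 : 0 <= r ^+ 2 by exact: sqr_ge0.
have p0 : 0 < p by apply: lt_le_trans p1.
rewrite (ge0_integral_sqn_scale _ _ (fun t => (g (1 * t + r ^+ 2))%:E) r)//;
    last 2 first.
- apply/measurable_EFinP; apply: (measurableT_comp mg).
  by apply: measurable_funD => //; apply: measurable_funM.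
- by move=> t; rewrite lee_fin.
under eq_integral => y _.
  rewrite (_ : g _ = gr (1 * sqn R y + 1)); last first.
    by rewrite /gr; congr g; ring.
  over.
have wE := wint_scale g r mg r0.
have h := HC gr mgr (fun t => g0 _).
apply: (@le_trans _ _ ((r ^+ k)%:E * (C%:E * wint gr `^ p^-1))%E).
  by apply: lee_wpmul2l => //; rewrite lee_fin exprn_ge0// ltW.
rewrite wE poweRM ?wint_ge0 ?lee_fin ?powR_ge0// poweR_EFin -powRrM.
rewrite !muleA -!EFinM; apply: lee_wpmul2r; first exact: poweR_ge0.
rewrite lee_fin -powR_mulrn ?(ltW r0)// -mulrA -powRD; last first.
  by apply/implyP => _; rewrite gt_eqF.
by rewrite subrK mulrC.
Qed.

End Sufficiency.

(** * Integrals over almost every plane; the condition is sufficient *)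

Section PlaneIntegral.
Variables (R : realType) (n k : nat).
Hypothesis kn : (k.+1 <= n)%N.

Lemma measurable_aff_pt (x : n.-tuple R) (U : 'M[R]_(n, k)) :
  measurable_fun setT (aff_pt R x U).
Proof.
apply/measurable_fun_tnthP => i.
rewrite (_ : _ \o _ = fun y => tnth x i + \sum_(j < k) U i j * tnth y j).
  apply: measurable_funD => //; apply: measurable_sum => j.
  by apply: measurable_funM => //; exact: measurable_tnth.
by apply/funext => y; rewrite /= tnth_mktuple.
Qed.

Lemma ge0_integral_plane_of (q : (k.+1 * n).-tuple R) (G : R -> \bar R) :
  \det (minor_mat R n k q) != 0 ->
  measurable_fun setT G -> (forall t, 0 <= G t)%E ->
  (\int[leb R k]_y G (sqn R (aff_pt R (frame R k (plane_of R q)).1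
      (frame R k (plane_of R q)).2 y)) =
   \int[leb R k]_y G (1 * sqn R y + dist0 R (plane_of R q) ^+ 2)%R)%E.
Proof.
move=> q0 mG G0; have h := is_frame_plane_of R n k q kn q0.
rewrite ge0_integral_frame//; last by case: h.
by rewrite (dist0_frame _ _ _ _ _ h) sqr_sqrtr// dotp_ge0.
Qed.

Lemma ae_nondegenerate (P : (k.+1 * n).-tuple R -> Prop) :
  (forall q, \det (minor_mat R n k q) != 0 -> P q) ->
  {ae leb R (k.+1 * n), forall q, P q}.
Proof.
move=> h; exists [set q | \det (minor_mat R n k q) = 0]; split.
- exact: measurable_degenerate.
- exact: leb_degenerate.
- by move=> q /=; apply: contra_notP => /eqP; exact: h.
Qed.

(** The bound is applied to [|f|]: it first makes [f] integrable on the plane, so that [radon] is a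
    genuine integral there, and then dominates its value. The two powers of the distance cancel. *)
Lemma radial_radon_ineq_sufficient (alpha p : R) :
  (1 <= k)%N -> 1 <= p -> k%:R * p < alpha + n%:R -> (2 <= k)%N \/ 2 < p ->
  radial_radon_ineq R n k alpha p ((alpha + n%:R) / p - k%:R).
Proof.
move=> k1 p1 pk kp.
have n1 : (1 <= n)%N by exact: leq_trans kn.
have [C C0 HC] := plane_bound R n k alpha p n1 k1 p1 pk kp.
exists C => f rf [mf ffin]; apply: ae_nondegenerate => q q0.
set r := dist0 R (plane_of R q).
have r0 : 0 < r by exact: dist0_plane_of_gt0.
pose g t := `|profile R n f t|.
have mg : measurable_fun setT g.
  by apply: measurableT_comp => //; exact: measurable_profile.
have wE : wint R n alpha p g = (\int[leb R n]_x (`|f x| `^ p * enorm R x `^ alpha)%:E)%E.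
  by apply: eq_integral => x _; rewrite /g -profileE.
have wfin : wint R n alpha p g \is a fin_num.
  by rewrite (ge0_fin_numE (wint_ge0 _ _ _ _ _)) wE; exact: ffin.
have NE : (wint R n alpha p g `^ p^-1 = (Lp_alpha_norm R p alpha f)%:E)%E.
  by rewrite /Lp_alpha_norm -wE -[in LHS](fineK wfin) poweR_EFin.
clear wE wfin.
have IE : (\int[leb R k]_y `|(on_plane R k f (plane_of R q) y)%:E| =
    \int[leb R k]_y (g (1 * sqn R y + r ^+ 2)%R)%:E)%E.
  have mgE : measurable_fun setT (EFin \o g) by apply/measurable_EFinP; exact: mg.
  have gE0 t : (0 <= (EFin \o g) t)%E by rewrite /= lee_fin; exact: normr_ge0.
  rewrite -(ge0_integral_plane_of q (EFin \o g) q0 mgE gE0).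
  by apply: eq_integral => y _; rewrite /= /g -profileE.
have IB := HC g r mg (fun t => normr_ge0 _) r0.
rewrite -IE NE -EFinM in IB; clear IE NE.
have mo : measurable_fun setT (fun y => (on_plane R k f (plane_of R q) y)%:E).
  apply/measurable_EFinP; apply: (measurableT_comp mf).
  exact: measurable_aff_pt.
have int : (leb R k).-integrable setT (fun y => (on_plane R k f (plane_of R q) y)%:E).
  by apply/integrableP; split => //; apply: le_lt_trans IB _; exact: ltry.
split=> //.
have RB : `|radon R k f (plane_of R q)| <=
    C * r `^ (k%:R - (alpha + n%:R) / p) * Lp_alpha_norm R p alpha f.
  rewrite -lee_fin; apply: le_trans IB.
  apply: le_trans (le_abse_integral (leb R k) measurableT mo).
  by rewrite /radon -abse_EFin fineK//; exact: integrable_fin_num.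
rewrite normrM ger0_norm ?powR_ge0//.
apply: le_trans (ler_wpM2l (powR_ge0 _ _) RB) _.
rewrite -opprB powRN -/r le_eqVlt; apply/orP; left; apply/eqP.
by field; rewrite powR_eq0 negb_and gt_eqF.
Qed.

End PlaneIntegral.

(** * Planes at prescribed distances *)

Section DistanceSets.
Variables (R : realType) (n k : nat).
Hypothesis kn : (k.+1 <= n)%N.
Local Notation m := (k.+1 * n)%N.

Lemma negligible_dilate c (A : set (m.-tuple R)) : 0 < c ->
  (leb R m).-negligible A -> (leb R m).-negligible (dilate R m c @^-1` A).
Proof.
move=> c0 [B [mB B0 AB]]; exists (dilate R m c @^-1` B); split.
- by rewrite -[X in measurable X]setTI; apply: measurable_scale_shift.
- have := leb_scale R m c B c0 mB; rewrite B0 => /esym/eqP.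
  rewrite mule_eq0 => /orP[|/eqP//].
  by rewrite eqe expf_eq0 (gt_eqF c0) andbF.
- by move=> y /AB.
Qed.

Lemma leb_setT_neq0 : leb R m setT != 0%E.
Proof.
rewrite gt_eqF//; apply: (@lt_le_trans _ _ (leb R m (cube R m))).
  by rewrite leb_cube lte_fin exprn_gt0.
by apply: le_measure; rewrite ?inE//; exact: measurable_cube.
Qed.

(* A null set of distances would, after dilating the parameter by the powers
   of b / a, cover almost the whole parameter space. *)
Lemma dist0_itv_non_negligible (a b : R) : 0 < a -> a < b ->
  ~ (leb R m).-negligible [set q | a <= dist0 R (plane_of R q) < b].
Proof.
move=> a0 ab; set S := [set q | _] => S0.
have lr0 : 0 < ln (b / a) by rewrite ln_gt0// ltr_pdivlMr// mul1r.
pose c (x : R) := expR (- (x * ln (b / a))).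
(* Dilations by [(b / a)^(-i)] and [(b / a)^i]: the two signs let a sequence over the naturals reach
   all integer powers. *)
pose T i := (dilate R m (c i%:R) @^-1` S) `|` (dilate R m (c (- i%:R)) @^-1` S).
have T0 : (leb R m).-negligible (\bigcup_i T i).
  apply: negligible_bigcup => i; apply: negligibleU;
    by apply: negligible_dilate => //; exact: expR_gt0.
have D0 : (leb R m).-negligible [set q | \det (minor_mat R n k q) = 0].
  exists [set q | \det (minor_mat R n k q) = 0]; split => //.
    exact: measurable_degenerate.
  exact: leb_degenerate.
have [B [mB B0 TB]] := negligibleU T0 D0.
suff BT : B = setT by move: leb_setT_neq0; rewrite -BT B0 eqxx.
rewrite -subTset; apply: subset_trans TB => q _.
have [q0|q0] := eqVneq (\det (minor_mat R n k q)) 0; [by right|left].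
set r := dist0 R (plane_of R q).
have r0 : 0 < r by exact: dist0_plane_of_gt0.
pose L := ln (r / a) / ln (b / a).
(* With this [z], dividing the distance [r] by [(b / a)^z] brings it into [[a, b[]. *)
pose z := Num.floor L.
have zL : z%:~R <= L by exact: ge_floor.
have Lz : L < z%:~R + 1.
  by have := lt_succ_floor L; rewrite -/z intrD.
have rE : r = a * expR (L * ln (b / a)).
  rewrite /L divfK ?gt_eqF// lnK ?posrE ?divr_gt0//.
  by rewrite mulrCA divff ?gt_eqF// mulr1.
have key : S (dilate R m (c z%:~R) q).
  rewrite /S /= dist0_dilate ?expR_gt0// -/r rE /c mulrCA -expRD.
  rewrite addrC -mulrBl; apply/andP; split.
    rewrite ler_peMr ?(ltW a0)//; apply: (@le_trans _ _ (expR 0)).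
      by rewrite expR0.
    by rewrite ler_expR mulr_ge0 ?(ltW lr0)// subr_ge0.
  apply: (@lt_le_trans _ _ (a * expR (1 * ln (b / a)))).
    by rewrite ltr_pM2l// ltr_expR ltr_pM2r// ltrBlDl.
  rewrite mul1r lnK ?posrE ?divr_gt0//; last exact: lt_trans ab.
  by rewrite mulrCA divff ?gt_eqF// mulr1.
case: z {zL Lz} key => i key; first by exists i => //; left.
exists i.+1 => //; right.
by rewrite /preimage /mkset; move: key; rewrite NegzE mulrNz.
Qed.

Lemma ae_exists_dist0 (P : m.-tuple R -> Prop) (a b : R) : 0 < a -> a < b ->
  {ae leb R m, forall q, P q} ->
  exists q, [/\ \det (minor_mat R n k q) != 0,
    a <= dist0 R (plane_of R q) < b & P q].
Proof.
move=> a0 ab aeP; apply: contrapT => h.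
apply: (dist0_itv_non_negligible a b a0 ab).
have D0 : {ae leb R m, forall q, \det (minor_mat R n k q) != 0}.
  exact: (ae_nondegenerate _ _ _ kn).
apply: negligibleS (negligibleU aeP D0).
move=> q rq; apply: contrapT => /not_orP[/contrapT Pq /contrapT q0].
by apply: h; exists q.
Qed.

(** An essential bound cannot be evaluated on a chosen plane, but a set of full measure meets the
    non-null set of planes with distance in a window, so every window contains an admissible [r].
    Passing to [|C|] makes the constant a nonnegative factor. *)
Lemma radial_radon_ineq_test (alpha p beta : R) :
  radial_radon_ineq R n k alpha p beta ->
  exists2 C : R, 0 <= C & forall (g : R -> R) (a b : R),
    measurable_fun setT g -> (forall t, 0 <= g t) ->
    (wint R n alpha p g < +oo)%E -> 0 < a -> a < b ->
    exists2 r, a <= r < b &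
      ((r `^ beta)%:E * \int[leb R k]_y (g (1 * sqn R y + r ^+ 2)%R)%:E <=
       C%:E * wint R n alpha p g `^ p^-1)%E.
Proof.
move=> [C HC]; exists `|C| => // g a b mg g0 gfin a0 ab.
pose f (x : n.-tuple R) := g (sqn R x).
have sqnE (x : n.-tuple R) : sqn R x = enorm R x ^+ 2.
  by rewrite enormE sqr_sqrtr ?sqn_ge0.
have rf : radial R f by move=> x y xy; rewrite /f !sqnE xy.
have mf : measurable_fun setT f.
  by apply: (measurableT_comp mg); exact: measurable_sqn.
have wE : wint R n alpha p g = (\int[leb R n]_x (`|f x| `^ p * enorm R x `^ alpha)%:E)%E.
  by apply: eq_integral => x _; rewrite /f ger0_norm ?g0.
have wfin : wint R n alpha p g \is a fin_num.
  by rewrite (ge0_fin_numE (wint_ge0 _ _ _ _ _)); exact: gfin.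
have NE : (wint R n alpha p g `^ p^-1 = (Lp_alpha_norm R p alpha f)%:E)%E.
  by rewrite /Lp_alpha_norm -wE -[in LHS](fineK wfin) poweR_EFin.
have Lf : in_Lp_alpha R p alpha f by split; [exact: mf|rewrite -wE; exact: gfin].
clear wE wfin.
have [q [q0 rq [int hq]]] := ae_exists_dist0 _ a b a0 ab (HC f rf Lf).
exists (dist0 R (plane_of R q)) => //.
have mgE : measurable_fun setT (EFin \o g) by apply/measurable_EFinP; exact: mg.
have gE0 t : (0 <= (EFin \o g) t)%E by rewrite /= lee_fin.
rewrite -(ge0_integral_plane_of _ _ _ kn q (EFin \o g) q0 mgE gE0) NE; clear NE.
have RE : (radon R k f (plane_of R q))%:E = (\int[leb R k]_y (EFin \o g) (sqn R
   (aff_pt R (frame R k (plane_of R q)).1 (frame R k (plane_of R q)).2 y)))%E.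
  by rewrite fineK//; exact: integrable_fin_num int.
rewrite -RE -EFinM -EFinM lee_fin.
apply: le_trans (ler_norm _) _; apply: le_trans hq _.
by apply: ler_wpM2r; [exact: powR_ge0|exact: ler_norm].
Qed.

End DistanceSets.

(** * Necessity of the exponent *)

Section Necessity.
Variable R : realType.
Local Notation mu := (@lebesgue_measure R).

(** Taking [l = (|K| + 1)^(1 / e)] gives [l^e > K] for either sign of [e]. *)
Lemma powR_bounded_exp0 (e K : R) :
  (forall l, 0 < l -> l `^ e <= K) -> e = 0.
Proof.
move=> h; apply/eqP/negPn/negP => e0.
have K0 : 0 < `|K| + 1 by rewrite ltr_wpDl.
have := h ((`|K| + 1) `^ e^-1) (powR_gt0 _ K0).
rewrite -powRrM mulVf// powRr1 ?(ltW K0)//.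
by have := ler_norm K; lra.
Qed.

(** The minimum serves both signs of [b]: for [b >= 0] the power is smallest at [1 / 2], for [b < 0]
    it is at least 1. *)
Lemma powR_lower_bound (b u : R) : 2^-1 <= u -> u < 1 ->
  Num.min 1 (2^-1 `^ b) <= u `^ b.
Proof.
move=> u0 u1; rewrite ge_min; have [b0|b0] := leP 0 b; apply/orP; [right|left].
  by apply: ge0_ler_powR; rewrite ?nnegrE//; lra.
by rewrite -(powRr0 u); apply: ger_powR; [lra|exact: ltW].
Qed.

Lemma powR_upper_bound (e t c : R) : 1 <= t -> t <= c -> t `^ e <= c `^ `|e|.
Proof.
move=> t1 tc; apply: (@le_trans _ _ (t `^ `|e|)).
  by apply: ler_powR => //; exact: ler_norm.
by apply: ge0_ler_powR; rewrite ?nnegrE//; lra.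
Qed.

Lemma min_powR_gt0 (b : R) : 0 < Num.min 1 (2^-1 `^ b).
Proof. by rewrite lt_min ltr01 powR_gt0// invr_gt0. Qed.

(** The bounds 1 and 3 leave room: adding [r^2] with [0 <= r^2 < 1] to a value in []1, 3]] stays
    inside []1, 4]], the support of the test profile up to scaling. *)
Lemma integral_shell_gt0 k : (0 < k)%N -> exists2 m0 : R, 0 < m0 &
  (\int[leb R k]_y (\1_(`]1, 3]%classic) (sqn R y))%:E = m0%:E)%E.
Proof.
move=> k0; exists (3 `^ (k%:R / 2) * ball_vol R k - ball_vol R k).
  rewrite subr_gt0 ltr_pMl ?ball_vol_gt0//.
  apply: (@le_lt_trans _ _ (1 `^ (k%:R / 2))); first by rewrite powR1.
  apply: gt0_ltr_powR; rewrite ?nnegrE ?divr_gt0 ?ltr0n//; lra.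
transitivity (leb R k (sball R k 3 `\` sball R k 1)).
  rewrite -[X in leb R k X]setIT -integral_indic//; last first.
    by apply: measurableD; exact: measurable_sball.
  apply: eq_integral => y _; rewrite !indicE; congr ((_ _)%:R)%:E.
  apply/idP/idP; rewrite !inE /sball /= in_itv/=.
    by move=> /andP[y1 y3]; split => //; apply/negP; rewrite -ltNge.
  by move=> [-> /negP]; rewrite -ltNge => ->.
have h3 : (leb R k (sball R k 3) < +oo)%E by rewrite leb_sballE// ltry.
apply: etrans (measureD (measurable_sball R k 3) (measurable_sball R k 1) h3) _.
rewrite (_ : _ `&` _ = sball R k 1); last first.
  apply/setIidPr => y; rewrite /sball /= => /le_trans; apply; lra.
rewrite EFinB; congr (_ - _)%E; first exact: leb_sballE.
by apply: etrans (leb_sballE _ _ _ ltr01) _; rewrite powR1 mul1r.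
Qed.

(** Up to constants, the shell of radius [l] makes the left side at least [l^(beta + k)] and the
    norm equal to [l^((alpha + n) / p)]; hence [l^(beta + k - (alpha + n) / p)] is bounded over all
    [l > 0], small and large. *)
Lemma necessity_beta n k (alpha p beta : R) :
  (0 < k)%N -> (k.+1 <= n)%N -> 1 <= p ->
  radial_radon_ineq R n k alpha p beta -> beta = (alpha + n%:R) / p - k%:R.
Proof.
move=> k0 kn p1 ineq; have p0 : 0 < p by lra.
have [C C0 HC] := radial_radon_ineq_test R n k kn alpha p beta ineq.
pose ind (c d t : R) : R := \1_(`]c, d]%classic) t.
have mind c d : measurable_fun setT (ind c d) by exact: measurable_indic.
have ind0 c d t : 0 <= ind c d t by rewrite /ind indicE.
pose W := wint R n alpha p (ind 1 4).
(* On the shell the weight is at most [4^|alpha / 2|] for either sign of [alpha], and the shell lies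
   in a ball of finite volume. *)
have Wfin : (W < +oo)%E.
  apply: (@le_lt_trans _ _
      (\int[leb R n]_x ((4 `^ `|alpha / 2|)%:E * (\1_(sball R n 4) x)%:E))%E).
    apply: ge0_le_integral => //.
    - by move=> x _; rewrite lee_fin mulr_ge0 ?powR_ge0.
    - apply/measurable_EFinP; under eq_fun do rewrite enorm_powR.
      apply: (@measurableT_comp _ _ _ _ _ _
        (fun t : R => ind 1 4 t `^ p * t `^ (alpha / 2)) _ (@sqn R n)); last first.
        exact: measurable_sqn.
      apply: measurable_funM; last exact: measurable_powR.
      by apply: (@measurableT_comp _ _ _ _ _ _ (@powR R ^~ p));
        first exact: measurable_powR.
    - apply: emeasurable_funM => //; apply/measurable_EFinP.
      by apply: measurable_indic; exact: measurable_sball.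
    move=> x _; rewrite -EFinM lee_fin enorm_powR /ind indicE.
    have [|_] := boolP (sqn R x \in _); last first.
      by rewrite powR0 ?gt_eqF// mul0r mulr_ge0 ?powR_ge0.
    rewrite inE/= in_itv/= => /andP[x1 x4].
    rewrite powR1 mul1r indicE mem_set// mulr1.
    by apply: powR_upper_bound => //; exact: ltW.
  rewrite ge0_integralZl_EFin//; last first.
    by apply/measurable_EFinP/measurable_indic; exact: measurable_sball.
  rewrite integral_indic//; last exact: measurable_sball.
  by rewrite /= setIT leb_sballE// -EFinM ltry.
have W0 : (0 <= W)%E by exact: wint_ge0.
have WE : W \is a fin_num by rewrite ge0_fin_numE.
have [m0 m0_gt0 m0E] := integral_shell_gt0 k k0.
pose cb := Num.min 1 (2^-1 `^ beta); have cb0 : 0 < cb := min_powR_gt0 beta.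
pose w := fine W `^ p^-1.
suff : beta + k%:R - (alpha + n%:R) / p = 0 by lra.
apply: (@powR_bounded_exp0 _ (C * w / (cb * m0))) => l l0.
have l2 : 0 < l ^+ 2 by rewrite exprn_gt0.
pose g := ind (l ^+ 2) (4 * l ^+ 2).
have indZ c d t : ind (c * l ^+ 2) (d * l ^+ 2) (l ^+ 2 * t) = ind c d t.
  rewrite /ind !indicE; congr (_ _)%:R; apply/idP/idP; rewrite !inE/= !in_itv/=;
    by rewrite [l ^+ 2 * t]mulrC ltr_pM2r// ler_pM2r.
have wE : wint R n alpha p g = ((l `^ (alpha + n%:R))%:E * W)%E.
  have gE : (fun t => g (l ^+ 2 * t)) = ind 1 4.
    by apply/funext => t; rewrite /g -[RHS]indZ mul1r.
  by rewrite (wint_scale R n alpha p g l (mind _ _) l0) gE.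
have wfin : (wint R n alpha p g < +oo)%E.
  by rewrite wE -(fineK WE) -EFinM ltry.
have lh : l / 2 < l by lra.
have [r /andP[rl rl'] hr] := HC g (l / 2) l (mind _ _) (ind0 _ _) wfin
  (divr_gt0 l0 (ltr0n _ 2)) lh.
have rl2 : r ^+ 2 < l ^+ 2 by rewrite ltr_pXn2r ?nnegrE//; lra.
have r2 : 0 <= r ^+ 2 := sqr_ge0 r.
have IB : ((l ^+ k * m0)%:E <=
    \int[leb R k]_y (g (1 * sqn R y + r ^+ 2)%R)%:E)%E.
  have mE (h : R -> R) : measurable_fun setT h ->
      measurable_fun setT (fun y : k.-tuple R => (h (sqn R y))%:E).
    move=> mh; apply/measurable_EFinP; apply: (measurableT_comp mh).
    exact: measurable_sqn.
  apply: (@le_trans _ _ (\int[leb R k]_y (ind (l ^+ 2) (3 * l ^+ 2) (sqn R y))%:E)%E).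
    rewrite (ge0_integral_sqn_scale _ _
      (fun t => (ind (l ^+ 2) (3 * l ^+ 2) t)%:E) l)//; last 2 first.
    - by apply/measurable_EFinP; exact: mind.
    - by move=> t; rewrite lee_fin.
    rewrite EFinM -m0E le_eqVlt; apply/orP; left; apply/eqP; congr (_ * _)%E.
    apply: eq_integral => y _; congr EFin.
    by have := indZ 1 3 (sqn R y); rewrite mul1r => ->.
  apply: ge0_le_integral => //.
  - by move=> y _; rewrite lee_fin.
  - exact: mE.
  - apply: (mE (fun t => g (1 * t + r ^+ 2))); apply: (measurableT_comp (mind _ _)).
    by apply: measurable_funD => //; apply: measurable_funM.
  move=> y _; rewrite lee_fin /g /ind !indicE.
  have [|_] := boolP (sqn R y \in _); last by [].
  rewrite inE/= in_itv/= => /andP[y1 y3].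
  by rewrite mem_set//= in_itv/=; apply/andP; split; lra.
have main : r `^ beta * (l ^+ k * m0) <= C * (l `^ ((alpha + n%:R) / p) * w).
  rewrite -lee_fin EFinM; apply: le_trans (le_trans _ hr) _.
    by apply: lee_wpmul2l => //; rewrite lee_fin powR_ge0.
  rewrite wE poweRM ?lee_fin ?powR_ge0// poweR_EFin -powRrM.
  by rewrite -[in leLHS](fineK WE) poweR_EFin -!EFinM.
have rb : cb * l `^ beta <= r `^ beta.
  have -> : r = r / l * l by rewrite divfK// gt_eqF.
  rewrite powRM ?(ltW l0)//; last by rewrite divr_ge0 ?(ltW l0)//; lra.
  rewrite ler_wpM2r ?powR_ge0//; apply: powR_lower_bound.
    by rewrite ler_pdivlMr// mulrC.
  by rewrite ltr_pdivrMr// mul1r.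
rewrite ler_pdivlMr ?mulr_gt0// powRB; last by apply/implyP => _; rewrite gt_eqF.
rewrite powRD; last by apply/implyP => _; rewrite gt_eqF.
rewrite powR_mulrn ?(ltW l0)//.
set P := l `^ ((alpha + n%:R) / p) in main *.
have P0 : 0 < P by rewrite powR_gt0.
have -> : l `^ beta * l ^+ k / P * (cb * m0) = cb * l `^ beta * (l ^+ k * m0) / P.
  by field; rewrite gt_eqF.
rewrite ler_pdivrMr//; apply: le_trans (_ : _ <= r `^ beta * (l ^+ k * m0)) _.
  by rewrite ler_wpM2r// mulr_ge0 ?exprn_ge0 ?ltW.
by apply: le_trans main _; rewrite le_eqVlt; apply/orP; left; apply/eqP; ring.
Qed.

End Necessity.

(** * Lines: the obstruction for [p <= 2] *)

Section LineNecessity.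
Variable R : realType.
Local Notation mu := (@lebesgue_measure R).

(* The extremal profile of the Cauchy-Schwarz inequality against the kernel
   (t - 1 + e) ^ (- 1 / 2) on [1, 2], before normalization. *)
Definition line_prof (e t : R) : R :=
  \1_(`[1, 2]%classic) t * (t - (1 - e)) `^ (- 2^-1).

Lemma measurable_line_prof e : measurable_fun setT (line_prof e).
Proof.
apply: measurable_funM => //.
apply: (@measurableT_comp _ _ _ _ _ _ (@powR R ^~ _)); first exact: measurable_powR.
exact: measurable_funB.
Qed.

Lemma line_prof_ge0 e t : 0 <= line_prof e t.
Proof. by rewrite mulr_ge0 ?powR_ge0// indicE. Qed.

Lemma line_profE e t : 1 <= t <= 2 -> line_prof e t = (t - (1 - e)) `^ (- 2^-1).
Proof. by move=> t12; rewrite /line_prof indicE mem_set ?mul1r//= in_itv. Qed.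

Lemma line_prof0 e t : ~~ (1 <= t <= 2) -> line_prof e t = 0.
Proof.
move=> t12; rewrite /line_prof indicE memNset ?mul0r//= in_itv/=.
exact/negP.
Qed.

(** The translation [t = s + 1 - e] turns the square into [1 / s] on [[e, 1 + e]]; its logarithmic
    divergence as [e] tends to 0 drives the counterexample. *)
Lemma integral_line_prof_sqr e : 0 < e ->
  (\int[mu]_t (line_prof e t ^+ 2)%:E = (ln (1 + e) - ln e)%:E)%E.
Proof.
move=> e0.
have m2 : measurable_fun setT (fun t : R => (line_prof e t ^+ 2)%:E).
  apply/measurable_EFinP; apply: measurable_funX; exact: measurable_line_prof.
have p2 t : (0 <= (line_prof e t ^+ 2)%:E)%E by rewrite lee_fin sqr_ge0.
have := ge0_integral_affine R 1 (1 - e)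
  (fun t => (line_prof e t ^+ 2)%:E) ltr01 m2 p2.
rewrite invr1 mul1e => <-.
rewrite -(integral_inv_itvcc _ e (1 + e))//; last by lra.
rewrite [RHS]integral_mkcond; apply: eq_integral => s _; rewrite patchE.
have [|sI] := boolP (s \in `[e, 1 + e]%classic).
  rewrite inE/= in_itv/= => /andP[s1 s2]; have s0 : 0 <= s by lra.
  rewrite line_profE; last by apply/andP; split; lra.
  rewrite -powR_mulrn ?powR_ge0// -powRrM -(powR_inv1 s0).
  by apply: (congr1 EFin); congr (_ `^ _); [ring|lra].
move: sI; rewrite notin_setE/= in_itv/= => /negP sI.
rewrite line_prof0 ?expr0n//; apply: contra sI => /andP[s1 s2].
by apply/andP; split; lra.
Qed.

(** This is where [p <= 2] enters: on a bounded interval the square integral of a profile controls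
    its [p]-th power for all such [p] at once. *)
Lemma powR_le_1Dsqr (x p : R) : 0 <= x -> 0 < p -> p <= 2 ->
  x `^ p <= 1 + x ^+ 2.
Proof.
move=> x0 p0 p2; have [x1|x1] := leP x 1.
  apply: (@le_trans _ _ 1); last by rewrite lerDl sqr_ge0.
  apply: (@le_trans _ _ (1 `^ p)); last by rewrite powR1.
  by apply: ge0_ler_powR; rewrite ?nnegrE//; lra.
apply: (@le_trans _ _ (x ^+ 2)); last by rewrite lerDr.
by rewrite -powR_mulrn//; apply: ler_powR => //; lra.
Qed.

(** On [[1, 2]], [1 - e <= r^2] makes the true kernel [(t - r^2)^(-1/2)] at least
    [(t - (1 - e))^(-1/2)], the profile itself, so the pairing dominates the square integral of the
    profile. *)
Lemma line_prof_integral_ge m (e D L r c : R) : m = 1%N ->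
  0 < e -> 0 <= D -> 0 <= c -> 1 - e <= r ^+ 2 -> r ^+ 2 < 1 ->
  (\int[mu]_t (line_prof e t ^+ 2)%:E = L%:E)%E ->
  (forall t, 0 < t -> radial_density R m t = c * t `^ (1%:R / 2 - 1)) ->
  ((c * D * L)%:E <=
   \int[leb R m]_y (D * line_prof e (1 * sqn R y + r ^+ 2)%R)%:E)%E.
Proof.
move=> m1 e0 D0 c0 re r1 intL rdm.
have m0 : (0 < m)%N by rewrite m1.
have cD : 0 <= c * D by exact: mulr_ge0.
pose g t := D * line_prof e t.
have mg : measurable_fun setT g.
  by apply: measurable_funM => //; exact: measurable_line_prof.
have g0 t : 0 <= g t by rewrite mulr_ge0 ?line_prof_ge0.
have mgr : measurable_fun setT (fun t : R => (g (1 * t + r ^+ 2))%:E).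
  apply/measurable_EFinP; apply: (measurableT_comp mg).
  by apply: measurable_funD => //; apply: measurable_funM.
have gr0 t : (0 <= (g (1 * t + r ^+ 2))%:E)%E by rewrite lee_fin.
rewrite (ge0_integral_sqn R m (fun t => (g (1 * t + r ^+ 2))%:E) m0 mgr gr0).
pose H t := (g t * radial_density R m (t - r ^+ 2))%:E.
have mH : measurable_fun setT H.
  apply/measurable_EFinP; apply: measurable_funM => //.
  apply: (@measurableT_comp _ _ _ _ _ _ (radial_density R m)).
    exact: measurable_radial_density.
  exact: measurable_funB.
have H0 t : (0 <= H t)%E by rewrite lee_fin mulr_ge0// radial_density_ge0.
have HE : (\int[mu]_s H (1 * s + r ^+ 2)%R = \int[mu]_t H t)%E.
  by rewrite (ge0_integral_affine _ _ _ _ ltr01 mH H0) invr1 mul1e.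
rewrite [leRHS](_ : _ = \int[mu]_t H t)%E; last first.
  rewrite -HE; apply: eq_integral => s _; rewrite /H -EFinM; congr EFin.
  by congr (_ * radial_density R m _); ring.
clear HE.
have m2 : measurable_fun setT (fun t : R => (line_prof e t ^+ 2)%:E).
  apply/measurable_EFinP; apply: measurable_funX; exact: measurable_line_prof.
have p2 t : (0 <= (line_prof e t ^+ 2)%:E)%E by rewrite lee_fin sqr_ge0.
have -> : ((c * D * L)%:E =
    \int[mu]_t ((c * D)%:E * (line_prof e t ^+ 2)%:E))%E.
  by rewrite ge0_integralZl_EFin// intL.
clear intL.
apply: ge0_le_integral => //.
- by move=> t _; apply: mule_ge0; rewrite lee_fin ?sqr_ge0.
- exact: emeasurable_funM (measurable_cst _) m2.
move=> t _; have [t12|t12] := boolP (1 <= t <= 2); last first.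
  by rewrite line_prof0// expr0n mule0.
have /andP[t1 t2] := t12.
have tr : 0 < t - r ^+ 2 by lra.
have te : 0 < t - (1 - e) by lra.
rewrite /H -(EFinM (c * D)) lee_fin /g rdm// expr2 line_profE//.
have -> : 1%:R / 2 - 1 = - 2^-1 :> R by lra.
have AB : (t - (1 - e)) `^ (- 2^-1) <= (t - r ^+ 2) `^ (- 2^-1).
  rewrite !powRN lef_pV2 ?posrE ?powR_gt0//.
  by apply: ge0_ler_powR; rewrite ?nnegrE//; lra.
have A0 : 0 <= (t - (1 - e)) `^ (- 2^-1) := powR_ge0 _ _.
set A := (t - (1 - e)) `^ _ in A0 AB *; set B := (t - r ^+ 2) `^ _ in AB *.
rewrite (_ : c * D * (A * A) = c * D * A * A); last by ring.
rewrite (_ : D * A * (c * B) = c * D * A * B); last by ring.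
by apply: ler_wpM2l => //; exact: mulr_ge0.
Qed.

(* If p <= 2 then wint stays bounded along the normalized profiles, whereas
   their integrals over lines at distance close to 1 grow like sqrt (- ln e). *)
Lemma necessity_p n (alpha p beta : R) : (2 <= n)%N -> 1 <= p ->
  radial_radon_ineq R n 1 alpha p beta -> 2 < p.
Proof.
move=> n2 p1 ineq; rewrite ltNge; apply/negP => p2.
have p0 : 0 < p by lra.
have [C C0 HC] := radial_radon_ineq_test R n 1 n2 alpha p beta ineq.
have n0 : (0 < n)%N by exact: leq_trans n2.
pose c1 : R := 1%:R / 2 * ball_vol R 1; pose cn : R := n%:R / 2 * ball_vol R n.
have c10 : 0 < c1 by rewrite mulr_gt0 ?divr_gt0// ball_vol_gt0.
have cn0 : 0 < cn by rewrite mulr_gt0 ?divr_gt0 ?ltr0n// ball_vol_gt0.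
have rdE m t : 0 < t -> radial_density R m t =
    m%:R / 2 * ball_vol R m * t `^ (m%:R / 2 - 1).
  by move=> t0; rewrite /radial_density indicE mem_set ?mul1r//= in_itv/= t0.
have rdn t : 0 < t -> radial_density R n t = cn * t `^ (n%:R / 2 - 1) := rdE n t.
have rd1 t : 0 < t -> radial_density R 1 t = c1 * t `^ (1%:R / 2 - 1) := rdE 1%N t.
clearbody c1 cn.
pose ex : R := alpha / 2 + (n%:R / 2 - 1).
(* Bounds weight times radial density on [[1, 2]] for either sign of [ex]. *)
pose M := cn * 2 `^ `|ex|.
have M0 : 0 < M by rewrite mulr_gt0// powR_gt0.
pose cb := Num.min 1 (2^-1 `^ beta); have cb0 : 0 < cb := min_powR_gt0 R beta.
(* The inequality will force [sqrt L <= K], where [L] is the square integral of the profile; [e]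
   below is chosen to make [L] at least [K^2 + 1]. *)
pose K := C * (M * 2) `^ p^-1 / (cb * c1).
have KE : K * (cb * c1) = C * (M * 2) `^ p^-1.
  by rewrite /K divfK// gt_eqF// mulr_gt0.
clearbody K.
have K2 : 0 <= K ^+ 2 := sqr_ge0 K.
pose e := expR (- (K ^+ 2 + 1)).
have e0 : 0 < e := expR_gt0 _.
have e2 : e <= 2^-1.
  rewrite /e expRN lef_pV2 ?posrE ?expR_gt0//.
  by apply: le_trans (expR_ge1Dx _); lra.
pose L := ln (1 + e) - ln e.
have LK : K ^+ 2 + 1 <= L.
  rewrite /L {2}/e expRK opprK lerDr ln_ge0//; lra.
have L0 : 0 < L by lra.
have intL : (\int[mu]_t (line_prof e t ^+ 2)%:E = L%:E)%E.
  exact: integral_line_prof_sqr.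
clearbody L; clearbody e.
(* Normalization: [g] below has square integral 1. *)
pose D := (Num.sqrt L)^-1.
have sL0 : 0 < Num.sqrt L by rewrite sqrtr_gt0.
have D0 : 0 < D by rewrite invr_gt0.
have D2 : D ^+ 2 = L^-1 by rewrite exprVn sqr_sqrtr// ltW.
have DL : D * L = Num.sqrt L.
  by rewrite -[X in D * X = _](sqr_sqrtr (ltW L0)) /D expr2 mulKf ?gt_eqF.
clearbody D.
pose g t := D * line_prof e t.
have mg : measurable_fun setT g.
  by apply: measurable_funM => //; exact: measurable_line_prof.
have g0 t : 0 <= g t by rewrite mulr_ge0 ?line_prof_ge0// ltW.
have m2 : measurable_fun setT (fun t : R => (line_prof e t ^+ 2)%:E).
  apply/measurable_EFinP; apply: measurable_funX; exact: measurable_line_prof.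
(* On [[1, 2]], [g^p <= 1 + g^2], and each of the two terms integrates to 1; hence the factor 2. *)
have wB : (wint R n alpha p g <= (M * 2)%:E)%E.
  rewrite wint_polar//.
  have mI : measurable_fun setT (fun t : R => (\1_(`[1, 2]%classic) t : R)%:E).
    by apply/measurable_EFinP; exact: measurable_indic.
  have mJ : measurable_fun setT (fun t : R => (L^-1)%:E * (line_prof e t ^+ 2)%:E)%E.
    by apply: emeasurable_funM => //; exact: measurable_cst.
  have J0 t : (0 <= (L^-1)%:E * (line_prof e t ^+ 2)%:E)%E.
    by rewrite -EFinM lee_fin mulr_ge0 ?sqr_ge0// invr_ge0 ltW.
  have I0 t : (0 <= (\1_(`[1, 2]%classic) t : R)%:E)%E by rewrite lee_fin indicE.
  have -> : ((M * 2)%:E = \int[mu]_t (M%:E * ((\1_(`[1, 2]%classic) t)%:E +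
      (L^-1)%:E * (line_prof e t ^+ 2)%:E)))%E.
    rewrite ge0_integralZl_EFin//; last 3 first.
    - by move=> t _; rewrite adde_ge0.
    - exact: emeasurable_funD.
    - exact: ltW.
    have I1 : (\int[mu]_t (\1_(`[1, 2]%classic) t : R)%:E = 1%:E)%E.
      rewrite integral_indic//= setIT lebesgue_measure_itv/= lte_fin ifT; last by lra.
      by rewrite -EFinB; congr EFin; lra.
    have I2 : (\int[mu]_t ((L^-1)%:E * (line_prof e t ^+ 2)%:E) = 1%:E)%E.
      rewrite ge0_integralZl_EFin//.
      - by rewrite intL -EFinM mulVf ?gt_eqF.
      - by move=> t _; rewrite lee_fin sqr_ge0.
      - by rewrite invr_ge0 ltW.
    by rewrite ge0_integralD// I1 I2 -EFinD -EFinM; congr EFin; lra.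
  apply: ge0_le_integral => //.
  - move=> t _; rewrite lee_fin mulr_ge0 ?radial_density_ge0//.
    by rewrite mulr_ge0 ?powR_ge0.
  - apply/measurable_EFinP; apply: measurable_funM; last first.
      exact: measurable_radial_density.
    apply: measurable_funM; last exact: measurable_powR.
    apply: (@measurableT_comp _ _ _ _ _ _ (@powR R ^~ p)); last exact: mg.
    exact: measurable_powR.
  - exact: emeasurable_funM (measurable_cst _) (emeasurable_funD mI mJ).
  move=> t _; rewrite -(EFinM L^-1) -(EFinD (\1_(`[1, 2]%classic) t)).
  rewrite -(EFinM M) lee_fin.
  have [t12|t12] := boolP (1 <= t <= 2); last first.
    rewrite /g line_prof0// mulr0 powR0 ?gt_eqF// !mul0r.
    by rewrite expr0n mulr0 addr0 mulr_ge0 ?(ltW M0)// indicE.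
  rewrite indicE mem_set; last by rewrite /= in_itv.
  have /andP[t1 t2] := t12; have t0 : 0 < t by lra.
  rewrite -D2 -exprMn -/(g t) rdn// -mulrA [t `^ _ * _]mulrCA -powRD; last first.
    by apply/implyP => _; rewrite gt_eqF.
  rewrite -/ex mulrC /M.
  apply: ler_pM.
  - by apply: mulr_ge0; [exact: ltW|exact: powR_ge0].
  - exact: powR_ge0.
  - by rewrite ler_pM2l//; exact: powR_upper_bound.
  - exact: powR_le_1Dsqr.
have wfin : (wint R n alpha p g < +oo)%E by apply: le_lt_trans wB _; exact: ltry.
(* Every [r] in [[1 - e / 2, 1[] satisfies [1 - e <= r^2 < 1], because [(1 - e / 2)^2 >= 1 - e]. *)
have a0 : 0 < 1 - e / 2 by lra.
have a1 : 1 - e / 2 < 1 by lra.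
have [r /andP[r0 r1] hr] := HC g (1 - e / 2) 1 mg g0 wfin a0 a1.
have re : 1 - e <= r ^+ 2 by nra.
have r12 : r ^+ 2 < 1 by nra.
have IB : ((c1 * Num.sqrt L)%:E <=
    \int[leb R 1]_y (g (1 * sqn R y + r ^+ 2)%R)%:E)%E.
  have := line_prof_integral_ge 1 e D L r c1 erefl e0 (ltW D0) (ltW c10) re r12
    intL rd1.
  by rewrite -mulrA DL.
have main : cb * (c1 * Num.sqrt L) <= C * (M * 2) `^ p^-1.
  have rb : cb <= r `^ beta by apply: powR_lower_bound; lra.
  rewrite -lee_fin; apply: (@le_trans _ _ ((r `^ beta)%:E * (c1 * Num.sqrt L)%:E)%E).
    by rewrite -EFinM lee_fin ler_wpM2r// mulr_ge0 ?ltW.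
  apply: le_trans (le_trans _ hr) _.
    by apply: lee_wpmul2l => //; rewrite lee_fin powR_ge0.
  rewrite EFinM -poweR_EFin; apply: lee_wpmul2l; first by rewrite lee_fin.
  apply: gt0_ler_poweR => //; first by rewrite invr_ge0 ltW.
    by rewrite in_itv/= leey wint_ge0.
  by rewrite in_itv/= leey andbT lee_fin mulr_ge0// ltW.
have sK : Num.sqrt L <= K.
  by rewrite -(ler_pM2r (mulr_gt0 cb0 c10)) KE mulrC -mulrA.
have : L <= K ^+ 2.
  rewrite -[leLHS]sqr_sqrtr ?(ltW L0)// ler_pXn2r ?nnegrE ?(ltW sL0)//.
  exact: le_trans (ltW sL0) sK.
lra.
Qed.

End LineNecessity.

Theorem theorem4p2 (R : realType) (n k : nat) (alpha p beta : R) :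
  (2 <= n)%N -> (1 <= k <= n.-1)%N ->
  k%:R - n%:R < alpha -> 1 <= p -> p < (alpha + n%:R) / k%:R ->
  ((2 <= k)%N ->
     (radial_radon_ineq R n k alpha p beta <->
      beta = (alpha + n%:R) / p - k%:R)) /\
  (k = 1%N ->
     (radial_radon_ineq R n k alpha p beta <->
      beta = (alpha + n%:R) / p - k%:R /\ 2 < p)).
Proof.
move=> n2 /andP[k1 kn1] _ p1 pk.
have kn : (k.+1 <= n)%N by case: n n2 kn1 pk.
have k0 : 0 < k%:R :> R by rewrite ltr0n.
have {}pk : k%:R * p < alpha + n%:R by rewrite mulrC -ltr_pdivlMr.
split=> [k2|k1E]; split.
- exact: necessity_beta.
- by move=> ->; apply: radial_radon_ineq_sufficient => //; left.
- move=> ineq; split; first exact: necessity_beta ineq.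
  by apply: (necessity_p R n alpha p beta n2 p1); rewrite -k1E.
- by move=> [-> p2]; apply: radial_radon_ineq_sufficient => //; right.
Qed.
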